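(* Let $S\in\mathbb R^{n\times n}$ be an identifying score matrix and let $A\in\mathcal D_n$. Then the $S$-induced Birkhoff decomposition of $A$ can be computed in $O(n^5)$ time by the following algorithm, which returns exactly the terms with non-zero coefficient, in order: set $B_1=A$ and $k=1$; while $B_k\neq 0$, set $P_k=\mathrm{argmax}_{P\in\mathcal P(B_k)}\langle P,S\rangle$, $\alpha_k=\min_{i,j}\{B_k(i,j)\mid P_k(i,j)=1\}$, $B_{k+1}=B_k-\alpha_kP_k$, and increase $k$ by one; when the loop ends, return the list of all computed pairs $(\alpha_k,P_k)$.
   Context: $\mathcal D_n$ is the set of $n\times n$ doubly stochastic matrices (non-negative entries, every row and column sums to $1$); $\mathcal P_n$ is the set of $n\times n$ permutation matrices. For a non-negative matrix $B$, $\mathcal P(B)$ is the set of perfect matchings of $B$, i.e. of $P\in\mathcal P_n$ such that $P(i,j)=1$ implies $B(i,j)>0$. A score matrix is a matrix $S\in\mathbb R^{n\times n}$; the score of $P\in\mathcal P_n$ is $\langle S,P\rangle=\sum_{i,j}S(i,j)P(i,j)$. $S$ is identifying if distinct permutation matrices have distinct scores; it then induces a total order $\{P_\ell\}_{\ell=1}^{n!}$ on $\mathcal P_n$ by decreasing score (highest score first). The $S$-induced Birkhoff decomposition of $A$ is $(\alpha_\ell,P_\ell)_{\ell=1}^{n!}$, where $\{P_\ell\}$ is the order induced by $S$ and, recursively for $\ell=1,\dots,n!$, $$\alpha_\ell=\min_{i,j}\Big\{A(i,j)-\sum_{m=1}^{\ell-1}\alpha_mP_m(i,j)\ \Big|\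 P_\ell(i,j)=1\Big\}.$$ Running time counts arithmetic operations and comparisons on real numbers as unit cost. *)

(* Defs.v *)
From mathcomp Require Import all_boot all_order all_fingroup all_algebra.
From mathcomp Require Import reals.

Set Implicit Arguments.
Unset Strict Implicit.
Unset Printing Implicit Defensive.

Import Order.TTheory GRing.Theory Num.Theory.
Local Open Scope ring_scope.

Section Birkhoff.

Variables (R : realType) (n : nat).
Implicit Types (A B P Q S : 'M[R]_n) (L : seq (R * 'M[R]_n)).

Definition doubly_stochastic A : Prop :=
  [/\ forall i j, 0 <= A i j,
      forall i, \sum_j A i j = 1
    & forall j, \sum_i A i j = 1].

Definition perfect_matching B P : Prop :=
  is_perm_mx P /\ forall i j, P i j = 1 -> 0 < B i j.

Definition score S P : R := \sum_i \sum_j S i j * P i j.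

Definition identifying S : Prop :=
  forall P Q, is_perm_mx P -> is_perm_mx Q -> P <> Q -> score S P <> score S Q.

(* All n! permutation matrices, highest score first. *)
Definition score_order S : seq 'M[R]_n :=
  sort (fun P Q => score S Q <= score S P) [seq perm_mx s | s : 'S_n].

(* min {B i j | P i j = 1}.  The [head] only provides a starting value for the
   iterated minimum; for 0 < n and P a permutation matrix the list is not
   empty. *)
Definition min_entry B P : R :=
  let s := [seq B ij.1 ij.2 | ij <- enum {: 'I_n * 'I_n} & P ij.1 ij.2 == 1] in
  \big[Order.min/head 0 s]_(x <- s) x.

Definition induced_decomposition S A : seq (R * 'M[R]_n) :=
  foldl (fun L P => rcons L (min_entry (A - \sum_(m <- L) m.1 *: m.2) P, P))
        [::] (score_order S).

Definition nonzero_terms L : seq (R * 'M[R]_n) := [seq m <- L | m.1 != 0].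

Definition is_argmax S B P : Prop :=
  perfect_matching B P /\
  forall Q, perfect_matching B Q -> score S Q <= score S P.

(* [birkhoff_run S B L cs]: the while loop, entered with current matrix B and
   list L of already computed pairs, halts, and cs lists the successive values
   of (current matrix, list of computed pairs) each time the loop condition is
   evaluated.  The returned list is the second component of the last element
   of cs. *)
Inductive birkhoff_run S :
    'M[R]_n -> seq (R * 'M[R]_n) -> seq ('M[R]_n * seq (R * 'M[R]_n)) -> Prop :=
| run_stop L : birkhoff_run S 0 L [:: (0, L)]
| run_iter B L P cs :
    B <> 0 -> is_argmax S B P ->
    birkhoff_run S (B - min_entry B P *: P) (rcons L (min_entry B P, P)) cs ->
    birkhoff_run S B L ((B, L) :: cs).

End Birkhoff.

(* A real RAM, presented as a while language.  The memory consists of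
   two-dimensional arrays (named by natural numbers), one family holding
   natural numbers, used for indices, and one holding reals.  A scalar is the
   entry (0, 0) of an array.  The two sorts do not mix: there is no rounding,
   and reals influence the control flow through comparisons only.  Real
   literals are restricted to 0 and 1, so that a program cannot hide
   information in a constant, and index arithmetic to successor and
   predecessor, so that in time t no index grows by more than O(t). *)
Inductive iexp : Type :=
| IConst of nat
| IGet of nat & iexp & iexp
| ISucc of iexp
| IPred of iexp.

Inductive rexp : Type :=
| RZero
| ROne
| RGet of nat & iexp & iexp
| RAdd of rexp & rexp
| RSub of rexp & rexp
| RMul of rexp & rexp
| RDiv of rexp & rexp.

Inductive bexp : Type :=
| BILe of iexp & iexp
| BRLe of rexp & rexp
| BNot of bexp
| BAnd of bexp & bexp.

Inductive com : Type :=
| Skip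
| ISet of nat & iexp & iexp & iexp
| RSet of nat & iexp & iexp & rexp
| Seq of com & com
| If of bexp & com & com
| While of bexp & com.

Section RealRAM.

Variable R : realType.

Record state : Type := State {
  imem : nat -> nat -> nat -> nat;
  rmem : nat -> nat -> nat -> R
}.

Implicit Type s : state.

Definition update (T : Type) (m : nat -> nat -> nat -> T) (a i j : nat) (v : T) :
    nat -> nat -> nat -> T :=
  fun a' i' j' => if [&& a' == a, i' == i & j' == j] then v else m a' i' j'.

Fixpoint ieval s (e : iexp) : nat :=
  match e with
  | IConst k => k
  | IGet a i j => imem s a (ieval s i) (ieval s j)
  | ISucc e1 => (ieval s e1).+1
  | IPred e1 => (ieval s e1).-1
  end.

Fixpoint reval s (e : rexp) : R :=
  match e with
  | RZero => 0
  | ROne => 1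
  | RGet a i j => rmem s a (ieval s i) (ieval s j)
  | RAdd e1 e2 => reval s e1 + reval s e2
  | RSub e1 e2 => reval s e1 - reval s e2
  | RMul e1 e2 => reval s e1 * reval s e2
  | RDiv e1 e2 => reval s e1 / reval s e2
  end.

Fixpoint beval s (b : bexp) : bool :=
  match b with
  | BILe e1 e2 => (ieval s e1 <= ieval s e2)%N
  | BRLe e1 e2 => reval s e1 <= reval s e2
  | BNot b1 => ~~ beval s b1
  | BAnd b1 b2 => beval s b1 && beval s b2
  end.

End RealRAM.

(* Every node of an expression has cost 1.  Division is total (x / 0 = 0), as in
   the library. *)
Fixpoint icost (e : iexp) : nat :=
  match e with
  | IConst _ => 1%N
  | IGet _ i j => (1 + icost i + icost j)%N
  | ISucc e1 | IPred e1 => (1 + icost e1)%N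
  end.

Fixpoint rcost (e : rexp) : nat :=
  match e with
  | RZero | ROne => 1%N
  | RGet _ i j => (1 + icost i + icost j)%N
  | RAdd e1 e2 | RSub e1 e2 | RMul e1 e2 | RDiv e1 e2 =>
      (1 + rcost e1 + rcost e2)%N
  end.

Fixpoint bcost (b : bexp) : nat :=
  match b with
  | BILe e1 e2 => (1 + icost e1 + icost e2)%N
  | BRLe e1 e2 => (1 + rcost e1 + rcost e2)%N
  | BNot b1 => (1 + bcost b1)%N
  | BAnd b1 b2 => (1 + bcost b1 + bcost b2)%N
  end.

(* [exec c s s' t]: started in s, the program c halts in s' after time t. *)
Inductive exec (R : realType) : com -> state R -> state R -> nat -> Prop :=
| exec_skip s : exec Skip s s 1%N
| exec_iset a i j e s :
    exec (ISet a i j e) s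
      (State (update (imem s) a (ieval s i) (ieval s j) (ieval s e)) (rmem s))
      (1 + icost i + icost j + icost e)%N
| exec_rset a i j e s :
    exec (RSet a i j e) s
      (State (imem s) (update (rmem s) a (ieval s i) (ieval s j) (reval s e)))
      (1 + icost i + icost j + rcost e)%N
| exec_seq c1 c2 s1 s2 s3 t1 t2 :
    exec c1 s1 s2 t1 -> exec c2 s2 s3 t2 -> exec (Seq c1 c2) s1 s3 (t1 + t2)%N
| exec_if b c1 c2 s s' t :
    exec (if beval s b then c1 else c2) s s' t ->
    exec (If b c1 c2) s s' (1 + bcost b + t)%N
| exec_while_stop b c s :
    ~~ beval s b -> exec (While b c) s s (1 + bcost b)%N
| exec_while_iter b c s1 s2 s3 t1 t2 :
    beval s1 b -> exec c s1 s2 t1 -> exec (While b c) s2 s3 t2 ->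
    exec (While b c) s1 s3 (1 + bcost b + t1 + t2)%N.

(* The successive memory states in which [While b c], started in the given
   state, evaluates its condition. *)
Inductive loop_heads (R : realType) (b : bexp) (c : com) :
    state R -> seq (state R) -> Prop :=
| heads_stop s : ~~ beval s b -> loop_heads b c s [:: s]
| heads_iter s s' t hs :
    beval s b -> exec c s s' t -> loop_heads b c s' hs ->
    loop_heads b c s (s :: hs).

(* Memory layout.  Index arrays: 0 holds n, 1 the number of pairs computed so
   far, and row k of 2 the permutation of the k-th pair (0-based), the entry at
   i being the column of the 1 in row i.  Real arrays: 0 holds S, 1 holds A,
   2 holds the current matrix B, and row 0 of 3 the coefficients.  All other
   memory is scratch space and initially has arbitrary contents. *)
Section Layout.

Variables (R : realType) (n : nat).
Implicit Types (A B S : 'M[R]_n) (L : seq (R * 'M[R]_n)) (s : state R).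

Definition stores_mx (a : nat) B s : Prop :=
  forall i j : 'I_n, rmem s a i j = B i j.

Definition stores_terms L s : Prop :=
  imem s 1 0 0 = size L /\
  forall k : nat, (k < size L)%N ->
    rmem s 3 0 k = (nth (0, 0) L k).1 /\
    forall i j : 'I_n, (imem s 2 k i = j :> nat) <-> ((nth (0, 0) L k).2 i j = 1).

Definition holds_input S A s : Prop :=
  [/\ imem s 0 0 0 = n, stores_mx 0 S s & stores_mx 1 A s].

Definition holds_config (cfg : 'M[R]_n * seq (R * 'M[R]_n)) s : Prop :=
  stores_mx 2 cfg.1 s /\ stores_terms cfg.2 s.

(* The loop [While b c] entered in s carries out, iteration by iteration, the
   run cs. *)
Definition loop_follows (b : bexp) (c : com) s
    (cs : seq ('M[R]_n * seq (R * 'M[R]_n))) : Prop :=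
  exists hs : seq (state R),
    [/\ loop_heads b c s hs, size hs = size cs
      & forall k : nat, (k < size cs)%N ->
          holds_config (nth (0, [::]) cs k) (nth s hs k)].

End Layout.

(* Main.v *)
Require Import Defs.
From mathcomp Require Import all_boot all_order all_fingroup all_algebra.
From mathcomp Require Import reals.
From mathcomp Require Import zify ring lra.

Set Implicit Arguments.
Unset Strict Implicit.
Unset Printing Implicit Defensive.

Import Order.TTheory GRing.Theory Num.Theory.
Local Open Scope ring_scope.

(* The program keeps, between iterations, a permutation matching columns to rows
   together with potentials [u], [v] that are feasible on the support of the
   current matrix B, i.e. S i j <= u i + v j whenever 0 < B i j.  A column is
   tight when its matched entry lies in the support and attains equality; by
   linear programming duality the permutation is the argmax once every column
   is tight.  Non-tight columns are repaired one at a time by a step of the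
   Hungarian method, whose alternating tree can always be extended because the
   row and column sums of B are all equal and positive.  Such a step takes time
   O(n^3) and keeps tight columns tight; as subtracting a permutation matrix
   spoils exactly the columns whose entry leaves the support, there are at most
   n + n^2 steps in the whole run.

   The induced decomposition agrees with the run because a permutation passed
   over with coefficient 0 is not a perfect matching of the current matrix, nor
   of any later one, so the next one with a non-zero coefficient is the argmax. *)

(** * The run and the induced decomposition *)

Section Decomposition.

Variables (R : realType) (n : nat).
Implicit Types (A B P Q S : 'M[R]_n) (L : seq (R * 'M[R]_n)).

Definition nonnegative B : Prop := forall i j, 0 <= B i j.

Lemma is_perm_mx_perm P : is_perm_mx P -> exists s : 'S_n, P = perm_mx s.
Proof. by move/existsP => [s /eqP ->]; exists s. Qed.

Lemma perm_mx_eq1 (s : 'S_n) i j : (perm_mx s i j == 1 :> R) = (s i == j).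
Proof. by rewrite !mxE; case: (s i == j); rewrite ?eqxx // eq_sym oner_eq0. Qed.

Lemma min_entry_le B P i j : P i j = 1 -> min_entry B P <= B i j.
Proof.
move=> Pij; rewrite /min_entry; set s := [seq _ | _ <- _ & _].
have : B i j \in s.
  apply/mapP; exists (i, j) => //.
  by rewrite mem_filter /= Pij eqxx mem_enum.
move: (head 0 s) => x0; elim: s => // x s IHs.
rewrite in_cons big_cons ge_min => /orP[/eqP ->|/IHs ->]; first by rewrite lexx.
by rewrite orbT.
Qed.

Lemma min_entry_attained B P : (0 < n)%N -> is_perm_mx P ->
  exists i j, P i j = 1 /\ min_entry B P = B i j.
Proof.
move=> n0 /is_perm_mx_perm[t Pt]; rewrite /min_entry; set s := [seq _ | _ <- _ & _].
(* As [0 < n], the list is not empty, so the default of [head] never occurs and the iterated minimum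
   stays within [s]. *)
have s0 : head 0 s \in s.
  have : B (Ordinal n0) (t (Ordinal n0)) \in s.
    apply/mapP; exists (Ordinal n0, t (Ordinal n0)) => //.
    by rewrite mem_filter /= Pt perm_mx_eq1 eqxx mem_enum.
  by case: (s) => // x s' _; rewrite mem_head.
have : \big[Order.min/head 0 s]_(x <- s) x \in s.
  move: (head 0 s) s0 => x0 s0.
  suff H r : {subset r <= s} -> \big[Order.min/x0]_(x <- r) x \in s by exact: H.
  elim: r => [|x r IHr] rs; first by rewrite big_nil.
  rewrite big_cons /Order.min; case: ifP => _; first by apply/rs/mem_head.
  by apply/IHr => y yr; apply/rs; rewrite in_cons yr orbT.
case/mapP => -[i j]; rewrite mem_filter /= => /andP[/eqP Pij _] ->.
by exists i, j.
Qed.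

Lemma is_argmax_unique S B P Q : identifying S ->
  is_argmax S B P -> is_argmax S B Q -> P = Q.
Proof.
move=> idS [[pP mP] maxP] [[pQ mQ] maxQ]; apply/eqP/negPn/negP => /eqP PQ.
by case: (idS _ _ pP pQ PQ); apply/le_anti; rewrite maxP // maxQ.
Qed.

Lemma birkhoff_run_unique S B L cs cs' : identifying S ->
  birkhoff_run S B L cs -> birkhoff_run S B L cs' -> cs' = cs.
Proof.
move=> idS H; elim: H cs' => {B L cs} [L|B L P cs B0 argP _ IH] cs' H.
  by inversion H.
inversion H as [|B' L' Q cs1 _ argQ H1]; first by subst.
by subst; congr (_ :: _); apply: IH; rewrite (is_argmax_unique idS argP argQ).
Qed.

Lemma min_entry_ge0 B P : (0 < n)%N -> is_perm_mx P -> nonnegative B ->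
  0 <= min_entry B P.
Proof.
by move=> n0 pP B0; have [i [j [_ ->]]] := min_entry_attained B n0 pP.
Qed.

Lemma sub_min_entry_nonnegative B P : (0 < n)%N -> is_perm_mx P ->
  nonnegative B -> nonnegative (B - min_entry B P *: P).
Proof.
move=> n0 pP B0 i j; have [s Ps] := is_perm_mx_perm pP; rewrite !mxE.
have [Pij|Pij] := boolP (P i j == 1).
  by rewrite (eqP Pij) mulr1 subr_ge0 min_entry_le //; apply/eqP.
suff -> : P i j = 0 by rewrite mulr0 subr0.
by move: Pij; rewrite Ps perm_mx_eq1 !mxE => /negbTE ->.
Qed.

(** The minimum is attained at an entry matched by [P], so for a non-negative matrix it vanishes
    exactly when some matched entry is not positive. *)
Lemma perfect_matching_min_entry B P : (0 < n)%N -> is_perm_mx P ->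
  nonnegative B -> perfect_matching B P <-> min_entry B P != 0.
Proof.
move=> n0 pP B0; split=> [[_ mP]|m0].
  have [i [j [Pij ->]]] := min_entry_attained B n0 pP.
  by rewrite gt_eqF // mP.
split=> // i j Pij; apply: lt_le_trans (min_entry_le B Pij).
by rewrite lt_neqAle eq_sym m0 min_entry_ge0.
Qed.

(** Subtraction only shrinks the support, and the entry attaining the minimum becomes 0, so [P]
    itself stops being a matching. *)
Lemma perfect_matching_sub B P Q : (0 < n)%N -> is_perm_mx P ->
  nonnegative B -> perfect_matching (B - min_entry B P *: P) Q ->
  perfect_matching B Q /\ Q <> P.
Proof.
move=> n0 pP B0 [pQ mQ]; have [s Ps] := is_perm_mx_perm pP; split; last first.
  move=> QP; have [i [j [Pij mij]]] := min_entry_attained B n0 pP.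
  by have := mQ i j; rewrite QP !mxE Pij mulr1 mij subrr ltxx => /(_ erefl).
split=> // i j /mQ; rewrite !mxE => /lt_le_trans; apply.
rewrite gerBl mulr_ge0 ?min_entry_ge0 // Ps !mxE.
by case: (_ == _).
Qed.

Lemma perfect_matching_neq0 B P : (0 < n)%N -> perfect_matching B P -> B <> 0.
Proof.
move=> n0 [/is_perm_mx_perm[s ->] mP] B0.
have /mP : (perm_mx s : 'M[R]_n) (Ordinal n0) (s (Ordinal n0)) = 1.
  by apply/eqP; rewrite perm_mx_eq1.
by rewrite B0 mxE ltxx.
Qed.

Lemma birkhoff_run_induced_suffix S A d Ps L B cs :
  (0 < n)%N -> identifying S ->
  (forall P, P \in Ps -> is_perm_mx P) ->
  sorted (fun P Q => score S Q <= score S P) Ps ->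
  B = A - \sum_(m <- L) m.1 *: m.2 -> nonnegative B ->
  (forall P, perfect_matching B P -> P \in Ps) ->
  birkhoff_run S B (nonzero_terms L) cs ->
  (last d cs).2 = nonzero_terms
    (foldl (fun L P => rcons L (min_entry (A - \sum_(m <- L) m.1 *: m.2) P, P))
       L Ps).
Proof.
move=> n0 idS; elim: Ps d L B cs => [|P Ps IH] d L B cs permPs sortPs BE B0 mPs.
  move=> /= H; inversion H as [|B' L' Q cs1 _ argQ]; first by [].
  by case: argQ => /mPs.
have pP : is_perm_mx P by apply: permPs; rewrite mem_head.
have permPs' Q : Q \in Ps -> is_perm_mx Q.
  by move=> QPs; apply: permPs; rewrite in_cons QPs orbT.
have sortPs' := path_sorted sortPs.
have Pmax Q : Q \in Ps -> score S Q <= score S P.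
  move: sortPs => /= /order_path_min H QPs.
  have /allP := H (fun y x z Hxy Hyz => le_trans Hyz Hxy); exact.
rewrite /= -BE; have [m0|mN0] := eqVneq (min_entry B P) 0; last first.
  have mP := (perfect_matching_min_entry n0 pP B0).2 mN0.
  have argP : is_argmax S B P.
    split=> // Q /mPs; rewrite in_cons => /orP[/eqP -> //|]; exact: Pmax.
  move=> H; inversion H as [L1 E|B' L' Q cs1 _ argQ H1].
    by case: (perfect_matching_neq0 n0 mP).
  rewrite /=; apply: (IH _ _ (B - min_entry B P *: P)) => //.
  - by rewrite -cats1 big_cat big_seq1 /= {1}BE opprD addrA.
  - exact: sub_min_entry_nonnegative.
  - move=> Q' /(perfect_matching_sub n0 pP B0)[/mPs].
    by rewrite in_cons => /orP[/eqP|].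
  - move: H1; rewrite -(is_argmax_unique idS argP argQ).
    by rewrite /nonzero_terms filter_rcons /= mN0.
move=> H; apply: (IH d _ B) => //.
- by rewrite -cats1 big_cat big_seq1 /= m0 scale0r addr0.
- move=> Q mQ; move: (mPs _ mQ); rewrite in_cons => /orP[/eqP QP|//].
  by move: mQ; rewrite QP => /(perfect_matching_min_entry n0 pP B0); rewrite m0 eqxx.
- by rewrite /nonzero_terms filter_rcons /= m0 eqxx.
Qed.

Lemma birkhoff_run_induced S A d cs :
  (0 < n)%N -> identifying S -> nonnegative A -> birkhoff_run S A [::] cs ->
  (last d cs).2 = nonzero_terms (induced_decomposition S A).
Proof.
move=> n0 idS A0 H; apply: (@birkhoff_run_induced_suffix S A d (score_order S) [::] A) => //.
- move=> P; rewrite mem_sort => /mapP[s _ ->]; exact: perm_mx_is_perm.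
- by apply: sort_sorted => P Q; exact: le_total.
- by rewrite big_nil subr0.
- move=> P [/is_perm_mx_perm[s ->] _]; rewrite mem_sort.
  by apply/mapP; exists s; rewrite // mem_enum.
Qed.

End Decomposition.

(** * Constant line sums and optimality certificates *)

Section Matching.

Variables (R : realType) (n : nat).
Implicit Types (A B P Q S : 'M[R]_n).

Definition line_sums (x : R) B : Prop :=
  [/\ nonnegative B, forall i, \sum_j B i j = x & forall j, \sum_i B i j = x].

(** A counting argument as for Hall's condition: if [B] vanished on the rows [T] outside the columns
    [U], the mass [#|T| * x] of these rows would have to fit into columns of total mass
    [#|U| * x]. *)
Lemma line_sums_escape x B (T U : {set 'I_n}) :
  line_sums x B -> 0 < x -> (#|U| < #|T|)%N ->
  exists i j, [/\ i \in T, j \notin U & 0 < B i j].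
Proof.
move=> [B0 rows cols] x0 UT.
have [/existsP[i /existsP[j /and3P[iT jU Bij]]]|/existsPn none] :=
  boolP [exists i, exists j, [&& i \in T, j \notin U & 0 < B i j]].
  by exists i, j.
have B_eq0 i j : i \in T -> j \notin U -> B i j = 0.
  move=> iT jU; have /existsPn/(_ j) := none i.
  by rewrite iT jU /= -leNgt => Bij; apply/le_anti; rewrite Bij B0.
have : #|T|%:R * x <= #|U|%:R * x.
  have -> : #|T|%:R * x = \sum_(j in U) \sum_(i in T) B i j.
    rewrite exchange_big /= mulr_natl -sumr_const; apply: eq_bigr => i iT.
    rewrite -(rows i) (bigID (mem U)) /= [X in _ + X]big1 ?addr0 // => j.
    exact: B_eq0.
  rewrite mulr_natl -sumr_const; apply: ler_sum => j _.
  rewrite -(cols j) [leRHS](bigID (mem T)) /= lerDl sumr_ge0 //.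
by rewrite (ler_pM2r x0) ler_nat leqNgt UT.
Qed.

(** Justifies testing the single scalar that holds the common sum instead of the whole matrix. *)
Lemma line_sums_eq0 x B : (0 < n)%N -> line_sums x B -> x <= 0 <-> B = 0.
Proof.
move=> n0 [B0 rows _]; split=> [x0|B_eq0]; last first.
  rewrite -(rows (Ordinal n0)) big1 // => j _.
  by rewrite B_eq0 mxE.
apply/matrixP => i j; rewrite mxE; apply/le_anti; rewrite B0 andbT.
apply: le_trans x0; by rewrite -(rows i) (bigD1 j) //= lerDl sumr_ge0 //.
Qed.

Lemma line_sums_sub x B (t : 'S_n) : (0 < n)%N -> line_sums x B ->
  let P := perm_mx t in
  line_sums (x - min_entry B P) (B - min_entry B P *: P).
Proof.
move=> n0 [B0 rows cols] P; split=> [|i|j].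
- by apply: sub_min_entry_nonnegative => //; exact: perm_mx_is_perm.
- transitivity (\sum_j (B i j - min_entry B P * (t i == j)%:R)).
    by apply: eq_bigr => j _; rewrite !mxE.
  rewrite sumrB rows -mulr_sumr (bigD1 (t i)) //= eqxx big1 ?addr0 ?mulr1 //.
  by move=> j; rewrite eq_sym => /negbTE ->.
- transitivity (\sum_i (B i j - min_entry B P * (t i == j)%:R)).
    by apply: eq_bigr => i _; rewrite !mxE.
  rewrite sumrB cols -mulr_sumr (bigD1 (t^-1%g j)) //= permKV eqxx big1 ?addr0 ?mulr1 //.
  by move=> i; rewrite (canF_eq (permK t)) => /negbTE ->.
Qed.

Lemma score_perm_mx S (t : 'S_n) : score S (perm_mx t) = \sum_i S i (t i).
Proof.
apply: eq_bigr => i _; rewrite (bigD1 (t i)) //= !mxE eqxx mulr1 big1 ?addr0 //.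
by move=> j; rewrite !mxE eq_sym => /negbTE ->; rewrite mulr0.
Qed.

(** Weak duality: the sum of [u i + v (q i)] is the same for every permutation [q]. Feasibility
    makes it an upper bound for the score of each matching, and tightness makes [t] attain it. *)
Lemma is_argmax_dual S B (u v : 'I_n -> R) (t : 'S_n) :
  (forall i j, 0 < B i j -> S i j <= u i + v j) ->
  (forall i, 0 < B i (t i)) -> (forall i, S i (t i) = u i + v (t i)) ->
  is_argmax S B (perm_mx t).
Proof.
move=> feas supp tight; split=> [|Q [/is_perm_mx_perm[q ->] mq]].
  split=> [|i j /eqP]; first exact: perm_mx_is_perm.
  by rewrite perm_mx_eq1 => /eqP <-.
have dual (w : 'S_n) : \sum_i (u i + v (w i)) = \sum_i u i + \sum_i v i.
  by rewrite big_split /=; congr (_ + _); rewrite [RHS](reindex_perm w).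
rewrite !score_perm_mx (eq_bigr _ (fun i _ => tight i)) dual -(dual q).
by apply: ler_sum => i _; apply/feas/mq/eqP; rewrite perm_mx_eq1.
Qed.

Definition support B : {set 'I_n * 'I_n} := [set ij | 0 < B ij.1 ij.2].

(** Here [t] sends columns to rows, hence the inverse in the matrix. The entries [(t j, j)] with [j]
    in [Z] lie in the support of [B] but not of [B'], so every column to be repaired is paid for by
    a lost entry. *)
Lemma card_support_sub B (t : 'S_n) :
  (0 < n)%N -> nonnegative B -> perfect_matching B (perm_mx t^-1) ->
  let B' := B - min_entry B (perm_mx t^-1) *: perm_mx t^-1 in
  let Z := [set j | ~~ (0 < B' (t j) j)] in
  (0 < #|Z|)%N /\ (#|support B'| + #|Z| <= #|support B|)%N.
Proof.
move=> n0 B0 [pP mP] B' Z; set P := perm_mx t^-1 in pP mP B' Z *.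
have Pt j : P (t j) j = 1 by apply/eqP; rewrite perm_mx_eq1 permK.
have B'le i j : B' i j <= B i j.
  by rewrite !mxE gerBl mulr_ge0 ?min_entry_ge0 // /P !mxE; case: (_ == _).
split.
  have [i [j [/eqP Pij mij]]] := min_entry_attained B n0 pP.
  move: Pij; rewrite perm_mx_eq1 (canF_eq (permKV t)) => /eqP itj.
  apply/card_gt0P; exists j; rewrite inE; move: mij; rewrite itj => mij.
  by rewrite !mxE permK eqxx mulr1 -/P mij subrr ltxx.
have inj : injective (fun j => (t j, j)) by move=> j k [].
rewrite -(card_imset (mem Z) inj) -cardsUI.
suff -> : support B' :&: [set (t j, j) | j in Z] = set0.
  rewrite cards0 addn0; apply/subset_leq_card/subsetP => -[i j].
  rewrite in_setU => /orP[|/imsetP[k _ [-> ->]]]; rewrite !inE /=.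
    by move/lt_le_trans; apply.
  exact: mP.
apply/setP => ij; rewrite !inE; apply/negP => /andP[H /imsetP[k]].
by rewrite inE => /negP kZ E; apply: kZ; rewrite E in H.
Qed.

End Matching.

(** * Execution with time bounds *)

Section Wp.

Variable R : realType.
Implicit Types (s : state R) (c : com) (Q : state R -> nat -> Prop).

(** Total correctness: termination is included, and the postcondition also receives the running
    time. *)
Definition wp c s Q : Prop := exists s' t, exec c s s' t /\ Q s' t.

Lemma wp_mono c s Q Q' : wp c s Q -> (forall s' t, Q s' t -> Q' s' t) -> wp c s Q'.
Proof. by move=> [s' [t [H Qs]]] QQ'; exists s', t; split=> //; exact: QQ'. Qed.

Lemma wp_skip s Q : Q s 1%N -> wp Skip s Q.
Proof. by move=> Qs; exists s, 1%N; split=> //; exact: exec_skip. Qed.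

Definition iset s a i j v := State (update (imem s) a i j v) (rmem s).
Definition rset s a i j v := State (imem s) (update (rmem s) a i j v).

Lemma wp_iset a i j e s Q :
  Q (iset s a (ieval s i) (ieval s j) (ieval s e))
    (1 + icost i + icost j + icost e)%N ->
  wp (ISet a i j e) s Q.
Proof. by move=> Qs; do 2!eexists; split; [exact: exec_iset|exact: Qs]. Qed.

Lemma wp_rset a i j e s Q :
  Q (rset s a (ieval s i) (ieval s j) (reval s e))
    (1 + icost i + icost j + rcost e)%N ->
  wp (RSet a i j e) s Q.
Proof. by move=> Qs; do 2!eexists; split; [exact: exec_rset|exact: Qs]. Qed.

Lemma wp_seq c1 c2 s Q :
  wp c1 s (fun s1 t1 => wp c2 s1 (fun s2 t2 => Q s2 (t1 + t2)%N)) ->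
  wp (Seq c1 c2) s Q.
Proof.
move=> [s1 [t1 [H1 [s2 [t2 [H2 Qs]]]]]]; exists s2, (t1 + t2)%N.
by split=> //; exact: exec_seq H1 H2.
Qed.

Lemma wp_if b c1 c2 s Q :
  wp (if beval s b then c1 else c2) s (fun s' t => Q s' (1 + bcost b + t)%N) ->
  wp (If b c1 c2) s Q.
Proof.
by move=> [s' [t [H Qs]]]; exists s', (1 + bcost b + t)%N; split=> //; exact: exec_if.
Qed.

(* As every iteration takes time, the potential [tau] also proves termination. *)
Lemma wp_while_amortized b c s (I : state R -> Prop) (tau : state R -> nat) Q :
  (forall s1, I s1 -> beval s1 b ->
     wp c s1 (fun s2 t => I s2 /\ (1 + bcost b + t + tau s2 <= tau s1)%N)) ->
  I s ->
  (forall s' t, I s' -> ~~ beval s' b -> (t + tau s' <= tau s + (1 + bcost b))%N -> Q s' t) ->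
  wp (While b c) s Q.
Proof.
move=> step Is HQ.
suff [s' [t [H Is' bs' ts']]] : exists s' t,
    [/\ exec (While b c) s s' t, I s', ~~ beval s' b & (t + tau s' <= tau s + (1 + bcost b))%N].
  by exists s', t; split=> //; exact: HQ.
have [m tau_m] := ubnP (tau s); elim: m => // m IH in s Is tau_m {HQ} *.
have [bs|bs] := boolP (beval s b); last first.
  exists s, (1 + bcost b)%N; split=> //; first exact: exec_while_stop.
  by rewrite addnC.
have [s1 [t1 [H1 [Is1 tau1]]]] := step _ Is bs.
have [||s2 [t2 [H2 Is2 bs2 t2s]]] := IH s1 => //; first by lia.
exists s2, (1 + bcost b + t1 + t2)%N; split=> //; last by lia.
exact: exec_while_iter H1 H2.
Qed.

(** Here [tau] also pays for the last, failing test, so that it bounds the time by itself. *)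
Lemma wp_while b c s (I : state R -> Prop) (tau : state R -> nat) Q :
  (forall s1, I s1 -> beval s1 b ->
     wp c s1 (fun s2 t => I s2 /\ (1 + bcost b + t + tau s2 <= tau s1)%N)) ->
  (forall s1, I s1 -> ~~ beval s1 b -> (1 + bcost b <= tau s1)%N) ->
  I s ->
  (forall s' t, I s' -> ~~ beval s' b -> (t <= tau s)%N -> Q s' t) ->
  wp (While b c) s Q.
Proof.
move=> step stop Is HQ; apply: (wp_while_amortized step Is) => s' t Is' bs' tle.
by apply: HQ => //; have := stop _ Is' bs'; lia.
Qed.

(** The bound [hi] is evaluated anew at each test, so the rules below ask every iteration to
    preserve its value as well as the counter. *)
Definition For a hi c : com :=
  Seq (ISet a (IConst 0) (IConst 0) (IConst 0))
      (While (BNot (BILe hi (IGet a (IConst 0) (IConst 0))))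
             (Seq c (ISet a (IConst 0) (IConst 0)
                       (ISucc (IGet a (IConst 0) (IConst 0)))))).

(** The 4 is the cost of resetting the counter, [20 + icost hi] covers a test and an increment, and
    [N.+1] leaves room for the failing test. An iteration may exceed [K] by what it takes out of the
    potential [phi]. *)
Lemma wp_for_amortized a hi c s N K (I : nat -> state R -> Prop) (phi : state R -> nat) Q :
  ieval (iset s a 0 0 0) hi = N ->
  I 0%N (iset s a 0 0 0) ->
  (forall k s1, (k < N)%N -> I k s1 -> imem s1 a 0%N 0%N = k ->
     wp c s1 (fun s2 t => [/\ imem s2 a 0%N 0%N = k,
        ieval (iset s2 a 0 0 k.+1) hi = N, I k.+1 (iset s2 a 0 0 k.+1) &
        (t + phi (iset s2 a 0 0 k.+1) <= K + phi s1)%N])) ->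
  (forall s' t, I N s' ->
     (t + phi s' <= 4 + N.+1 * (20 + icost hi + K) + phi (iset s a 0 0 0))%N -> Q s' t) ->
  wp (For a hi c) s Q.
Proof.
move=> hiN I0 step HQ; apply/wp_seq/wp_iset.
apply: (@wp_while_amortized _ _ _ (fun s1 => exists k, [/\ (k <= N)%N, imem s1 a 0%N 0%N = k,
    ieval s1 hi = N & I k s1])
   (fun s1 => (N - imem s1 a 0%N 0%N) * (20 + icost hi + K) + phi s1)%N).
- move=> s1 [k [kN s1k hi1 I1]]; rewrite /= hi1 s1k -ltnNge => {}kN.
  apply/wp_seq; apply: wp_mono (step k s1 kN I1 s1k) _ => s2 t1 [s2k hi2 I2 t1K].
  apply: wp_iset; rewrite /= s2k; split.
    by exists k.+1; split; rewrite // /update !eqxx.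
  rewrite /update !eqxx /=.
  have -> : (N - k = (N - k.+1).+1)%N by lia.
  rewrite mulSn; lia.
- by exists 0%N; split; [|rewrite /= /update !eqxx|exact: hiN|exact: I0].
- move=> s' t [k [kN s'k hi' I']] /=; rewrite hi' s'k negbK => Nk.
  have kE : k = N by lia.
  rewrite {1}/update !eqxx subn0 => tK; apply: HQ; first by rewrite -kE.
  by rewrite mulSn; lia.
Qed.

Lemma wp_for a hi c s N K (I : nat -> state R -> Prop) Q :
  ieval (iset s a 0 0 0) hi = N ->
  I 0%N (iset s a 0 0 0) ->
  (forall k s1, (k < N)%N -> I k s1 -> imem s1 a 0%N 0%N = k ->
     wp c s1 (fun s2 t => [/\ imem s2 a 0%N 0%N = k,
        ieval (iset s2 a 0 0 k.+1) hi = N, I k.+1 (iset s2 a 0 0 k.+1) & (t <= K)%N])) ->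
  (forall s' t, I N s' -> (t <= 4 + N.+1 * (20 + icost hi + K))%N -> Q s' t) ->
  wp (For a hi c) s Q.
Proof.
move=> hiN I0 step HQ; apply: (wp_for_amortized (K := K) (phi := fun=> 0%N) hiN I0) => [k s1 *|s' t].
  by apply: wp_mono (step k s1 _ _ _) _ => // s2 t; rewrite !addn0.
by rewrite !addn0; exact: HQ.
Qed.

End Wp.

(** * The program *)

Section Frames.

Variable R : realType.
Implicit Types (s : state R).

Definition frame (xs ys : seq nat) s s' : Prop :=
  (forall a i j, a \notin xs -> imem s' a i j = imem s a i j) /\
  (forall a i j, a \notin ys -> rmem s' a i j = rmem s a i j).

Lemma frame_refl xs ys s : frame xs ys s s. Proof. by []. Qed.

Lemma frame_iset xs ys s s' a i j v :
  a \in xs -> frame xs ys s s' -> frame xs ys s (iset s' a i j v).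
Proof.
move=> axs [Hi Hr]; split=> // a' i' j' a'xs; rewrite /= /update.
by case: eqP => [E|_]; [rewrite -E (negbTE a'xs) in axs|exact: Hi].
Qed.

Lemma frame_rset xs ys s s' a i j v :
  a \in ys -> frame xs ys s s' -> frame xs ys s (rset s' a i j v).
Proof.
move=> axs [Hi Hr]; split=> // a' i' j' a'xs; rewrite /= /update.
by case: eqP => [E|_]; [rewrite -E (negbTE a'xs) in axs|exact: Hr].
Qed.

Lemma frame_sub xs ys xs' ys' s s' :
  all (mem xs') xs -> all (mem ys') ys -> frame xs ys s s' -> frame xs' ys' s s'.
Proof.
by move=> /allP xs_sub /allP ys_sub [Hi Hr]; split=> a i j H; [apply: Hi|apply: Hr];
  apply: contra H => /=; [exact: xs_sub|exact: ys_sub].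
Qed.

Lemma frame_trans xs ys s s' s'' : frame xs ys s s' -> frame xs ys s' s'' -> frame xs ys s s''.
Proof. by move=> [Hi Hr] [Hi' Hr']; split=> a i j H; rewrite (Hi', Hr') ?(Hi, Hr). Qed.

End Frames.

Ltac frame_tac := repeat match goal with
  | |- frame _ _ _ (iset _ _ _ _ _) => apply: frame_iset; [by []|]
  | |- frame _ _ _ (rset _ _ _ _ _) => apply: frame_rset; [by []|]
  | |- frame _ _ ?s ?s => exact: frame_refl
  end.

Notation iv a := (IGet a (IConst 0) (IConst 0)) (only parsing).
Notation ia a i := (IGet a (IConst 0) i) (only parsing).
Notation rv a := (RGet a (IConst 0) (IConst 0)) (only parsing).
Notation ra a i := (RGet a (IConst 0) i) (only parsing).
Notation isetv a e := (ISet a (IConst 0) (IConst 0) e) (only parsing).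
Notation rsetv a e := (RSet a (IConst 0) (IConst 0) e) (only parsing).

(* Scratch memory.  Index arrays: 3 holds the row matched to each column, 4 and
   5 the rank and the parent of each column in the alternating tree, 6, 7 and 8
   loop counters, 9 the size of the tree, 10, 11 and 12 a flag and the two ends
   of the best edge leaving the tree, 13 the column being rematched.  Real
   arrays: 4 holds the common row and column sum of B, 5 and 6 the potentials
   of rows and columns, 7 the slack of the best edge, 8 the minimal entry. *)
Definition slack_exp (c j : iexp) : rexp :=
  RSub (RAdd (ra 5 (ia 3 c)) (ra 6 j)) (RGet 0 (ia 3 c) j).

(** The outer loop includes the dummy column [n], hence its successor bound; the inner one ranges
    over real columns. While the flag in array 10 is 0, the best slack counts as infinite. *)
Definition scan : com :=
  For 7 (ISucc (iv 0)) (For 8 (iv 0)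
    (If (BAnd (BILe (IConst 1) (ia 4 (iv 7)))
        (BAnd (BILe (ia 4 (iv 8)) (IConst 0))
        (BAnd (BNot (BRLe (RGet 2 (ia 3 (iv 7)) (iv 8)) RZero))
              (BNot (BAnd (BILe (IConst 1) (iv 10))
                          (BRLe (rv 7) (slack_exp (iv 7) (iv 8))))))))
        (Seq (isetv 10 (IConst 1))
        (Seq (isetv 11 (iv 7))
        (Seq (isetv 12 (iv 8))
             (rsetv 7 (slack_exp (iv 7) (iv 8))))))
        Skip)).

(** Lowering the potentials of tree rows and raising those of tree columns by the least slack makes
    the best leaving edge tight and preserves all slacks within the tree. *)
Definition dual_update : com :=
  For 7 (ISucc (iv 0))
    (If (BILe (IConst 1) (ia 4 (iv 7)))
        (Seq (RSet 5 (IConst 0) (ia 3 (iv 7)) (RSub (ra 5 (ia 3 (iv 7))) (rv 7)))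
             (RSet 6 (IConst 0) (iv 7) (RAdd (ra 6 (iv 7)) (rv 7))))
        Skip).

Definition grow : com :=
  Seq (isetv 10 (IConst 0))
  (Seq scan
  (Seq dual_update
  (Seq (ISet 5 (IConst 0) (iv 12) (iv 11))
  (Seq (isetv 9 (ISucc (iv 9)))
       (ISet 4 (IConst 0) (iv 12) (iv 9)))))).

(** Augmentation: following parents from the target column, each column takes over the row of its
    parent, until the dummy root [n] is reached. *)
Definition trace_loop : com :=
  While (BNot (BILe (iv 0) (iv 13)))
        (Seq (ISet 3 (IConst 0) (iv 13) (ia 3 (ia 5 (iv 13))))
             (isetv 13 (ia 5 (iv 13)))).

(** The row of the column to be repaired moves to the dummy column [n], the root of a new tree; the
    column itself becomes the hole, and the tree grows until it is reached. *)
Definition insert : com :=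
  Seq (For 7 (ISucc (iv 0)) (ISet 4 (IConst 0) (iv 7) (IConst 0)))
  (Seq (ISet 4 (IConst 0) (iv 0) (IConst 1))
  (Seq (ISet 3 (IConst 0) (iv 0) (ia 3 (iv 6)))
  (Seq (isetv 9 (IConst 1))
  (Seq (While (BILe (ia 4 (iv 6)) (IConst 0)) grow)
  (Seq (isetv 13 (iv 6))
       trace_loop))))).

(** The potentials start from arbitrary memory contents: those of the columns are kept, and those of
    the rows are raised until every constraint holds. *)
Definition initialise : com :=
  Seq (isetv 1 (IConst 0))
  (Seq (rsetv 4 ROne)
  (For 7 (iv 0)
    (Seq (ISet 3 (IConst 0) (iv 7) (iv 7))
    (For 8 (iv 0)
      (Seq (RSet 2 (iv 7) (iv 8) (RGet 1 (iv 7) (iv 8)))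
           (If (BRLe (RGet 0 (iv 7) (iv 8)) (RAdd (ra 5 (iv 7)) (ra 6 (iv 8))))
               Skip
               (RSet 5 (IConst 0) (iv 7)
                  (RSub (RGet 0 (iv 7) (iv 8)) (ra 6 (iv 8)))))))))).

Definition repair : com :=
  For 6 (iv 0)
    (If (BAnd (BNot (BRLe (RGet 2 (ia 3 (iv 6)) (iv 6)) RZero))
              (BRLe (slack_exp (iv 6) (iv 6)) RZero))
        Skip insert).

Definition find_min : com :=
  Seq (rsetv 8 (RGet 2 (ia 3 (IConst 0)) (IConst 0)))
      (For 7 (iv 0)
        (If (BRLe (RGet 2 (ia 3 (iv 7)) (iv 7)) (rv 8))
            (rsetv 8 (RGet 2 (ia 3 (iv 7)) (iv 7)))
            Skip)).

Definition subtract : com :=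
  For 7 (iv 0)
    (Seq (RSet 2 (ia 3 (iv 7)) (iv 7) (RSub (RGet 2 (ia 3 (iv 7)) (iv 7)) (rv 8)))
         (ISet 2 (iv 1) (ia 3 (iv 7)) (iv 7))).

Definition iteration : com :=
  Seq repair
  (Seq find_min
  (Seq subtract
  (Seq (RSet 3 (IConst 0) (iv 1) (rv 8))
  (Seq (rsetv 4 (RSub (rv 4) (rv 8)))
       (isetv 1 (ISucc (iv 1))))))).

Definition positive_sums : bexp := BNot (BRLe (rv 4) RZero).

(** * Correctness and running time of the program *)

Section Hungarian.

Variables (R : realType) (n : nat).
Hypothesis n_gt0 : (0 < n)%N.
Implicit Types (s : state R).

Local Notation p s c := (imem s 3 0%N c).
Local Notation used s c := (imem s 4 0%N c).
Local Notation way s c := (imem s 5 0%N c).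
Local Notation u s i := (rmem s 5 0%N i).
Local Notation v s c := (rmem s 6 0%N c).
Local Notation b s i c := (rmem s 2 i c).

(** * The best edge leaving the alternating tree *)

Definition slack s c j : R := u s (p s c) + v s j - rmem s 0 (p s c) j.

Definition crossing s c j : bool :=
  [&& (0 < used s c)%N, used s j == 0%N & 0 < b s (p s c) j].

(** The outcome of a search through the pairs in [V], which is a parameter so that partial searches
    are covered as well. *)
Definition best s (V : nat -> nat -> bool) s' : Prop :=
  (imem s' 10 0%N 0%N = 0%N /\ forall c j, V c j -> ~~ crossing s c j) \/
  exists c j,
    [/\ V c j, crossing s c j,
        [/\ imem s' 10 0%N 0%N = 1%N, imem s' 11 0%N 0%N = c & imem s' 12 0%N 0%N = j],
        rmem s' 7 0%N 0%N = slack s c j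
      & forall c' j', V c' j' -> crossing s c' j' -> slack s c j <= slack s c' j'].

Lemma best_ext s V V' s' : (forall c j, V c j = V' c j) -> best s V s' -> best s V' s'.
Proof.
move=> VV' [[found none]|[c [j [Vcj cr found d min]]]]; [left|right].
  by split=> // c j; rewrite -VV'; exact: none.
by exists c, j; split; rewrite // -?VV' // => c' j'; rewrite -VV'; exact: min.
Qed.

Lemma scan_spec s : imem s 0 0%N 0%N = n -> imem s 10 0%N 0%N = 0%N ->
  wp scan s (fun s' t =>
    [/\ frame [:: 7; 8; 10; 11; 12] [:: 7] s s',
        best s (fun c j => (c <= n) && (j < n))%N s' & (t <= 950 * (n * n))%N]).
Proof.
move=> sn s10; apply: (@wp_for _ _ _ _ _ n.+1 (290 * n) (fun k s1 =>
  frame [:: 7; 8; 10; 11; 12] [:: 7] s s1 /\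
  best s (fun c j => (c < k) && (j < n))%N s1)).
- by rewrite /= /update /= sn.
- by split; [exact: frame_iset|left].
- move=> k s1 kn [fr1 best1] s1k.
  have s1n : imem s1 0 0%N 0%N = n by rewrite fr1.1.
  apply: (@wp_for _ _ _ _ _ n 120 (fun l s2 => [/\
    imem s2 7 0%N 0%N = k, frame [:: 7; 8; 10; 11; 12] [:: 7] s s2 &
    best s (fun c j => (c < k) && (j < n) || (c == k) && (j < l))%N s2])) => //.
  + split=> //; first exact: frame_iset.
    by apply: best_ext best1 => c j; rewrite ltn0 andbF orbF.
  + move=> l s2 ln [s2k fr2 best2] s2l; apply: wp_if.
    have s2n : imem s2 0 0%N 0%N = n by rewrite fr2.1.
    set V := fun c j : nat => _ in best2.
    have V'E c j : ((c < k) && (j < n) || (c == k) && (j < l.+1))%N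
        = V c j || (c == k) && (j == l).
      rewrite /V ltnS [(j <= l)%N]leq_eqVlt; case: (c < k)%N; case: (j < n)%N;
        by case: (c == k); case: (j == l); case: (j < l)%N.
    set bt := beval s2 _.
    have -> : bt = crossing s k l &&
        ~~ ((0 < imem s2 10 0%N 0%N)%N && (rmem s2 7 0%N 0%N <= slack s k l)).
      rewrite /bt /= /crossing /slack s2k s2l leqn0 -ltNge.
      by rewrite !(fr2.1 4, fr2.1 3, fr2.2 2, fr2.2 5, fr2.2 6, fr2.2 0) // -!andbA.
    have [/andP[cr better]|old] := ifP.
      do 3!(apply/wp_seq/wp_iset); apply: wp_rset.
      set sl := reval _ _.
      have -> : sl = slack s k l.
        rewrite /sl /= /update /= /slack s2k s2l.
        by rewrite !(fr2.1 3, fr2.2 5, fr2.2 6, fr2.2 0).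
      split; [exact: s2l|exact: s2n| |by rewrite /=; lia].
      split; [exact: s2k|by frame_tac|].
      right; exists k, l; split=> //.
      + by rewrite !eqxx ltnSn orbT.
      + move=> c j; rewrite V'E => /orP[Vcj crcj|/andP[/eqP -> /eqP ->] //].
        case: best2 => [[_ /(_ _ _ Vcj)]|]; first by rewrite crcj.
        move=> [c' [j' [_ _ [found _ _] d min]]].
        move: better; rewrite found d /= -ltNge => /ltW /le_trans; apply.
        exact: min.
    apply: wp_skip; split; [exact: s2l|exact: s2n| |by rewrite /=; lia].
    split; [exact: s2k|by frame_tac|].
    case: best2 => [[nf none]|[c' [j' [Vcj' cr' [found c'E j'E] d min]]]].
      left; split=> // c j; rewrite V'E => /orP[/none //|/andP[/eqP -> /eqP ->]].
      by move: old; rewrite nf /= andbT => ->.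
    right; exists c', j'; split=> //; first by rewrite V'E Vcj'.
    move=> c j; rewrite V'E => /orP[/min //|/andP[/eqP -> /eqP ->] cr].
    by move: old; rewrite cr found d /= => /negbT; rewrite negbK.
  + move=> s' t [s'k fr' best'] tK; split=> //=.
    * by rewrite /update /= fr'.1 ?sn.
    * split; first exact: frame_iset.
      apply: best_ext best' => c j; rewrite ltnS [(c <= k)%N]leq_eqVlt.
      by case: (c < k)%N; case: (j < n)%N; case: (c == k).
    * apply: leq_trans tK _ => /=; nia.
- move=> s' t [fr' best'] tK; split=> //.
  apply: leq_trans tK _ => /=; nia.
Qed.

(* The columns in play are [0 .. n], [n] being a dummy column, except for the
   hole [h]; outside insertions the hole is [n] itself. *)
Definition in_play h c : bool := (c <= n)%N && (c != h).

(** For [h <= n] there are [n] columns in play, so by injectivity every row occurs among their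
    partners, and feasibility, though stated through columns, covers all rows. *)
Definition feasible_matching h s : Prop :=
  [/\ forall c, in_play h c -> (p s c < n)%N,
      forall c c', in_play h c -> in_play h c' -> p s c = p s c' -> c = c'
    & forall c j, in_play h c -> (j < n)%N -> 0 < b s (p s c) j -> 0 <= slack s c j].

Definition tight s c : bool := (0 < b s (p s c) c) && (slack s c c <= 0).

Lemma dual_update_spec s jj : imem s 0 0%N 0%N = n ->
  feasible_matching jj s -> used s jj = 0%N ->
  let d c := if (0 < used s c)%N then rmem s 7 0%N 0%N else 0 in
  wp dual_update s (fun s' t =>
    [/\ frame [:: 7] [:: 5; 6] s s',
        forall c, in_play jj c -> u s' (p s c) = u s (p s c) - d c,
        forall c, (c <= n)%N -> v s' c = v s c + d c & (t <= 400 * n)%N]).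
Proof.
move=> sn [_ inj _] jj0 d.
apply: (@wp_for _ _ _ _ _ n.+1 100 (fun k s1 => [/\ frame [:: 7] [:: 5; 6] s s1,
    forall c, in_play jj c -> u s1 (p s c) = u s (p s c) - (if (c < k)%N then d c else 0) &
    forall c, (c <= n)%N -> v s1 c = v s c + (if (c < k)%N then d c else 0)])).
- by rewrite /= /update /= sn.
- split=> [|c _|c _]; first by frame_tac.
    by rewrite subr0.
  by rewrite addr0.
- move=> k s1 kn [fr1 u1 v1] s1k.
  have s1n : imem s1 0 0%N 0%N = n by rewrite fr1.1.
  have step c : (if (c < k.+1)%N then d c else 0) =
      (if (c < k)%N then d c else 0) + (if c == k then d k else 0).
    rewrite ltnS leq_eqVlt; case: eqP => [->|_]; first by rewrite ltnn add0r.
    by rewrite addr0.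
  apply: wp_if; rewrite /= s1k !(fr1.1 4) //; case: ifP => [usedk|nusedk]; last first.
    apply: wp_skip; split=> //=; first by rewrite /update /= s1n.
    have dk : d k = 0 by rewrite /d nusedk.
    split=> [|c cj|c cn]; first by frame_tac.
      by rewrite u1 // step dk if_same addr0.
    by rewrite v1 // step dk if_same addr0.
  have dk : d k = rmem s 7 0%N 0%N by rewrite /d usedk.
  have kcol : in_play jj k.
    by rewrite /in_play -ltnS kn; apply: contraTneq usedk => ->; rewrite jj0.
  apply/wp_seq/wp_rset/wp_rset; rewrite /= /update /= s1k (fr1.1 3) // (fr1.2 7) // -dk.
  split=> //=.
  + by rewrite /update /= s1n.
  + split; first by frame_tac.
    (* Injectivity on the columns in play ensures that the potential of a row is lowered only
       once. *)
    * move=> c cj; rewrite /update /= step u1 // opprD addrA.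
      case: eqP => [/inj ->|ne]; rewrite ?eqxx //.
        by rewrite u1 // ltnn subr0.
      by case: (c =P k) => [ck|_]; [rewrite ck in ne|rewrite subr0].
    * move=> c cn; rewrite /update /= step v1 // addrA.
      by case: eqP => [->|_]; rewrite ?v1 // addr0.
- move=> s' t [fr' u' v'] tK; split=> //.
  + by move=> c cj; rewrite u' //; case/andP: cj => cn _; rewrite ltnS cn.
  + by move=> c cn; rewrite v' // ltnS cn.
  + by apply: leq_trans tK _ => /=; nia.
Qed.

(** The dummy column has a partner row but is no column of [B], so the rows of the tree outnumber
    its real columns, and positive mass must leave the tree. *)
Lemma crossing_exists s jj (B : 'M[R]_n) x :
  stores_mx 2 B s -> line_sums x B -> 0 < x ->
  feasible_matching jj s -> used s jj = 0%N -> (0 < used s n)%N ->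
  exists c j, [/\ (c <= n)%N, (j < n)%N & crossing s c j].
Proof.
move=> sB sumsB x0 [row inj _] jj0 usedn.
pose i0 : 'I_n := Ordinal n_gt0.
pose f (c : 'I_n.+1) : 'I_n := insubd i0 (p s c).
pose T' := [set c : 'I_n.+1 | (0 < used s c)%N].
pose U := [set j : 'I_n | (0 < used s j)%N].
have colT (c : 'I_n.+1) : c \in T' -> in_play jj c.
  rewrite inE /in_play leq_ord /= => uc.
  by apply: contraTneq uc => ->; rewrite jj0.
have fE (c : 'I_n.+1) : c \in T' -> f c = p s c :> nat.
  by move=> /colT/row pc; rewrite /f insubdK.
have UT : (#|U| < #|f @: T'|)%N.
  rewrite card_in_imset; last first.
    move=> c c' cT c'T /(congr1 val) /=; rewrite !fE // => pcc'.
    by apply/val_inj/inj => //; exact: colT.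
  have inj_w : injective (widen_ord (leqnSn n)) by move=> i j /(congr1 val) ij; apply/val_inj.
  rewrite -(card_imset (mem U) inj_w); apply: proper_card.
  apply/properP; split.
    by apply/subsetP => c /imsetP[j]; rewrite !inE => uj ->.
  exists ord_max; first by rewrite inE.
  apply/imsetP => -[j _ /(congr1 val) /= E].
  by have := ltn_ord j; rewrite -E ltnn.
have [i [j [/imsetP[c cT ->] jU Bij]]] := line_sums_escape sumsB x0 UT.
exists c, j; split; rewrite ?ltn_ord ?leq_ord //.
move: cT jU Bij; rewrite /crossing !inE -leqNgt leqn0 => cT -> /=.
by rewrite -sB fE ?inE // cT.
Qed.

Lemma slack_frame xs ys s s' c j : frame xs ys s s' ->
  3 \notin xs -> 0 \notin ys -> 5 \notin ys -> 6 \notin ys ->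
  slack s' c j = slack s c j.
Proof. by move=> fr *; rewrite /slack !(fr.1, fr.2). Qed.

Lemma feasible_matching_eq h s s' :
  (forall c, p s' c = p s c) -> (forall i j, b s' i j = b s i j) ->
  (forall c j, in_play h c -> (j < n)%N -> 0 < b s (p s c) j ->
     0 <= slack s c j -> 0 <= slack s' c j) ->
  feasible_matching h s -> feasible_matching h s'.
Proof.
move=> pE bE slackE [row inj feas]; split.
- by move=> c; rewrite pE; exact: row.
- by move=> c c'; rewrite !pE; exact: inj.
- by move=> c j ch jn; rewrite pE bE => bj; apply: slackE => //; exact: feas.
Qed.

Lemma feasible_matching_frame xs ys h s s' : frame xs ys s s' ->
  3 \notin xs -> 0 \notin ys -> 2 \notin ys -> 5 \notin ys -> 6 \notin ys ->
  feasible_matching h s -> feasible_matching h s'.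
Proof.
move=> fr *; apply: (@feasible_matching_eq h s s') => //.
- by move=> c; rewrite fr.1.
- by move=> i j; rewrite fr.2.
- by move=> c j *; rewrite (slack_frame _ _ fr).
Qed.

(** * Growth of the alternating tree *)

Definition unused s : {set 'I_n} := [set j : 'I_n | used s j == 0%N].

(* [s0] is the state at the start of the search. [used] holds the rank of a
   column in the alternating tree, 0 for columns outside it, and [way] the
   parent of a column, which is reached through the row matched to it. *)
Record tree jj s0 s : Prop := Tree {
  tree_frame : frame [:: 4; 5; 7; 8; 9; 10; 11; 12; 13] [:: 5; 6; 7] s0 s;
  tree_feasible : feasible_matching jj s;
  tree_root : used s n = 1%N;
  tree_count : (imem s 9 0%N 0%N + #|unused s|)%N = n.+1;
  tree_rank : forall c, (c <= n)%N -> (used s c <= imem s 9 0%N 0%N)%N;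
  tree_way : forall c, (c < n)%N -> (0 < used s c)%N ->
    [/\ in_play jj (way s c), (0 < used s (way s c) < used s c)%N,
        0 < b s (p s (way s c)) c & slack s (way s c) c <= 0];
  tree_slack : forall c, (c < n)%N -> c != jj -> slack s c c = slack s0 c c
}.

(** Only edges leaving the tree lose slack, and they lose the minimum over those in the support, so
    feasibility survives. The minimising edge becomes tight and attaches its column, with the new
    tree size as rank. *)
Lemma grow_spec jj s0 s (B : 'M[R]_n) x :
  imem s0 0 0%N 0%N = n -> stores_mx 2 B s0 -> line_sums x B -> 0 < x ->
  tree jj s0 s -> used s jj = 0%N ->
  wp grow s (fun s' t =>
    [/\ tree jj s0 s', (#|unused s'| < #|unused s|)%N & (t <= 1400 * (n * n))%N]).
Proof.
move=> s0n sB sumsB x0 [fr feas root count rank wayP slackP] jj0.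
have sn : imem s 0 0%N 0%N = n by rewrite fr.1.
have sB1 : stores_mx 2 B s by move=> i j; rewrite fr.2 ?sB.
apply/wp_seq/wp_iset; rewrite /=; set s1 := iset s _ _ _ _.
have fr1 : frame [:: 10] [::] s s1 by rewrite /s1; frame_tac.
apply: wp_seq; apply: wp_mono (scan_spec _ _) _ => // s2 t2 [fr2' best2 t2le].
have fr2 : frame [:: 7; 8; 10; 11; 12] [:: 7] s s2.
  by apply: frame_trans _ fr2'; exact: frame_sub fr1.
have [c [j [Vcj cr [_ s2c s2j] d min]]] : exists c j,
    [/\ (c <= n)%N && (j < n)%N, crossing s c j,
        [/\ imem s2 10 0%N 0%N = 1%N, imem s2 11 0%N 0%N = c & imem s2 12 0%N 0%N = j],
        rmem s2 7 0%N 0%N = slack s c j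
      & forall c' j', (c' <= n)%N && (j' < n)%N -> crossing s c' j' ->
          slack s c j <= slack s c' j'].
  case: best2 => [[_ none]|//].
  have [|c [j [cn jn cr]]] := crossing_exists sB1 sumsB x0 feas jj0.
    by rewrite root.
  by have := none c j; rewrite cn jn => /(_ isT)/negP; case; exact: cr.
have [cn jn] := andP Vcj; have [usedc /eqP usedj bcj] := and3P cr.
have colP a : (0 < used s a)%N -> (a <= n)%N -> in_play jj a.
  by rewrite /in_play => ua ->; apply: contraTneq ua => ->; rewrite jj0.
have cjj := colP c usedc cn.
have [row inj feas'] := feas.
have d0 : 0 <= slack s c j by exact: feas'.
have s2n : imem s2 0 0%N 0%N = n by rewrite fr2.1.
have feas2 : feasible_matching jj s2 by exact: feasible_matching_frame fr2 _ _ _ _ _ feas.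
apply: wp_seq; apply: wp_mono (dual_update_spec s2n feas2 _) _.
  by rewrite fr2.1.
move=> s3 t3 [fr3 u3 v3 t3le].
do 2!(apply/wp_seq/wp_iset); apply: wp_iset; rewrite /= /update /=.
rewrite !(fr3.1 11) // !(fr3.1 12) // !(fr3.1 9) // s2c s2j !(fr2.1 9) //.
set s4 := iset _ 4 _ _ _.
have fr23 : frame [:: 7; 8; 10; 11; 12] [:: 5; 6; 7] s s3.
  by apply: frame_trans (frame_sub _ _ fr2) (frame_sub _ _ fr3).
have fr4 : frame [:: 4; 5; 7; 8; 9; 10; 11; 12; 13] [:: 5; 6; 7] s s4.
  rewrite /s4; frame_tac.
  exact: frame_sub fr23.
have used4 a : used s4 a = if a == j then (imem s 9 0%N 0%N).+1 else used s a.
  by rewrite /s4 /= /update /= !fr23.1.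
have way4 a : way s4 a = if a == j then c else way s a.
  by rewrite /s4 /= /update /= !fr23.1.
have p4 a : p s4 a = p s a by rewrite fr4.1.
pose da a := if (0 < used s a)%N then slack s c j else 0.
(* A slack drops when its source is in the tree and rises when its target is, by the same amount;
   the invariants of the tree all rest on this formula. *)
have slack4 a l : in_play jj a -> (l <= n)%N -> slack s4 a l = slack s a l - da a + da l.
  move=> aj ln; rewrite {1}/slack p4 (fr4.2 0) //.
  have -> : u s4 (p s a) = u s (p s a) - da a.
    rewrite -[u s4 _]/(u s3 _) -(fr2.1 3 0%N a) // u3 // d !fr2.1 // fr2.2 //.
  have -> : v s4 l = v s l + da l.
    by rewrite -[v s4 _]/(v s3 _) v3 // d !fr2.1 // fr2.2.
  by rewrite /slack; ring.
have unused4 : unused s4 = unused s :\ Ordinal jn.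
  apply/setP => l; rewrite !inE used4.
  by rewrite -[l == Ordinal jn]/(l == j :> nat); case: (l == j :> nat).
have jun : Ordinal jn \in unused s by rewrite inE /= usedj.
have card4 : #|unused s| = (#|unused s4|).+1.
  by rewrite unused4 (cardsD1 (Ordinal jn)) jun.
have cnt4 : imem s4 9 0%N 0%N = (imem s 9 0%N 0%N).+1 by [].
have b4 i l : b s4 i l = b s i l by rewrite fr4.2.
have tight4 a l : (l < n)%N -> (0 < used s a)%N -> (a <= n)%N -> (0 < used s l)%N ->
    slack s4 a l = slack s a l.
  by move=> ln ua an ul; rewrite slack4 ?(ltnW ln) // ?colP // /da ua ul subrK.
have n_sq : (n <= n * n)%N by rewrite leq_pmulr.
split; [|by rewrite card4|by lia].
split.
- exact: frame_trans fr fr4.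
- apply: (@feasible_matching_eq jj s s4) => // a l aj ln bal sl0.
  rewrite slack4 ?(ltnW ln) // /da; have [ua|_] := ifP; last first.
    by rewrite subr0; case: ifP => _; rewrite ?addr0 // addr_ge0.
  case: ifP => [_|nul]; first by rewrite subrK.
  rewrite addr0 subr_ge0 min ?ln ?andbT //; first by case/andP: aj.
  by rewrite /crossing ua bal -leqn0 leqNgt nul.
- by rewrite used4 (gtn_eqF jn).
- by rewrite cnt4 -count card4; lia.
- move=> a an; rewrite used4 cnt4; case: eqP => // _.
  exact: leqW (rank _ an).
- move=> a an; rewrite used4 way4 p4 b4; case: (a =P j) => [-> _|aj ua].
    rewrite used4; have -> : (c == j) = false by apply: contraTF usedc => /eqP ->; rewrite usedj.
    split=> //; first by rewrite usedc ltnS rank.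
    by rewrite slack4 ?(ltnW jn) // /da usedc usedj /= addr0 subrr.
  have [wj /andP[uw uwa] bw slw] := wayP a an ua.
  rewrite used4; have -> : (way s a == j) = false by apply: contraTF uw => /eqP ->; rewrite usedj.
  by split; rewrite ?uw ?p4 // tight4 //; case/andP: wj.
- move=> a an ajj; rewrite slack4 ?(ltnW an) // ?subrK ?slackP //.
  by rewrite /in_play (ltnW an).
Qed.

(** * Augmentation along the tree path *)

Lemma feasible_matching_move h h' s : in_play h h' ->
  feasible_matching h s -> feasible_matching h' (iset s 3 0 h (p s h')).
Proof.
move=> hh' [row inj feas].
(* The stale copy of the row left at [h'] is harmless, because [h'] is the new hole. *)
have pE c : p (iset s 3 0 h (p s h')) c = p s (if c == h then h' else c).
  by rewrite /= /update /=; case: eqP.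
have slackE c j : slack (iset s 3 0 h (p s h')) c j = slack s (if c == h then h' else c) j.
  by rewrite /slack pE.
have play c : in_play h' c -> in_play h (if c == h then h' else c).
  by case: (eqVneq c h) => // ch; rewrite /in_play ch => /andP[-> _].
split.
- by move=> c /play; rewrite pE; exact: row.
- move=> c c' hc hc'; rewrite !pE => /inj -/(_ (play _ hc) (play _ hc')).
  case: (eqVneq c h) => [->|_]; case: (eqVneq c' h) => [->|_] // E.
    by move: hc'; rewrite /in_play -E eqxx andbF.
  by move: hc; rewrite /in_play E eqxx andbF.
- by move=> c j /play hc jn; rewrite pE slackE; exact: feas.
Qed.

(** Each step moves the hole to its tree parent, and the column left behind receives the parent's
    row along a supported edge without slack. Ranks strictly decrease, so the walk ends at [n], and
    the columns ahead still hold the rows they had in the tree. *)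
Lemma trace_spec jj s0 s : imem s 0 0%N 0%N = n -> (jj < n)%N ->
  tree jj s0 s -> (0 < used s jj)%N -> imem s 13 0%N 0%N = jj ->
  wp trace_loop s (fun s' t =>
    [/\ frame [:: 3; 13] [::] s s', feasible_matching n s',
        forall c, (c < n)%N -> (c == jj) || tight s c -> tight s' c
      & (t <= 100 * n)%N]).
Proof.
move=> sn jjn tr usedjj sjj.
have [_ feas root count rank wayP _] := tr.
pose I s' := let h := imem s' 13 0%N 0%N in
  [/\ frame [:: 3; 13] [::] s s', (h <= n)%N && (0 < used s h)%N, feasible_matching h s',
      forall a, (0 < used s a < used s h)%N -> p s' a = p s a
    & forall c, (c < n)%N -> c != h -> (c == jj) || tight s c -> tight s' c].
have cnt_le : (imem s 9 0%N 0%N <= n.+1)%N by rewrite -count leq_addr.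
apply: (@wp_while _ _ _ _ I (fun s' => 50 * used s (imem s' 13 0%N 0%N))%N).
- move=> s1 [fr1 /andP[hn uh] feas1 p1 tight1] /=.
  set h := imem s1 13 0%N 0%N in hn uh feas1 p1 tight1 *.
  rewrite fr1.1 // sn -ltnNge => {}hn.
  apply/wp_seq/wp_iset/wp_iset; rewrite /= /update /= -/h !(fr1.1 5) //.
  have [wjj /andP[uw uwh] bw slw] := wayP h hn uh.
  set w := way s h in wjj uw uwh bw slw *.
  have wn : (w <= n)%N by case/andP: wjj.
  have wh : w != h by apply: contraTneq uwh => ->; rewrite ltnn.
  set s2 := iset _ 13 _ _ _.
  have p2 c : p s2 c = if c == h then p s w else p s1 c.
    by rewrite /s2 /= /update /= p1 // uw uwh.
  have slack2 c j : slack s2 c j = if c == h then slack s w j else slack s1 c j.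
    by rewrite /slack p2; case: ifP => // _; rewrite /s2 /= !fr1.2.
  split; last by lia.
  split; rewrite -/w.
  + by rewrite /s2; frame_tac.
  + by rewrite wn uw.
  + have fr2 : frame [:: 13] [::] (iset s1 3 0 h (p s1 w)) s2.
      by rewrite /s2; apply: frame_iset => //; exact: frame_refl.
    apply: (feasible_matching_frame fr2) => //.
    by apply: feasible_matching_move => //; rewrite /in_play wn wh.
  + move=> a /andP[ua uaw]; have uah := ltn_trans uaw uwh.
    have /negbTE ah : a != h by apply: contraTneq uah => ->; rewrite ltnn.
    by rewrite p2 ah p1 // ua uah.
  + move=> c cn cw old; rewrite /tight p2 slack2 [rmem s2 _ _ _]fr1.2 //.
    have [->|ch] := eqVneq c h; first by rewrite bw slw.
    by have := tight1 c cn ch old; rewrite /tight fr1.2.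
- move=> s1 [_ /andP[_ uh] _ _ _] _ /=; lia.
- by split; rewrite ?sjj ?(ltnW jjn) ?usedjj //= => c cn /negbTE ->.
- move=> s' t [fr' /andP[hn _] feas' _ tight']; rewrite /= fr'.1 // sn negbK => nh tle.
  have hE : imem s' 13 0%N 0%N = n by lia.
  rewrite hE in feas' tight'; split=> //.
    by move=> c cn; apply: tight' => //; rewrite ltn_eqF.
  apply: leq_trans tle _; have := rank jj (ltnW jjn); rewrite sjj.
  lia.
Qed.

(** Each round of [grow] takes one of the [n] real columns into the tree, so there are at most [n]
    rounds of quadratic cost. Tightness of other columns survives: the dual updates keep the slack
    of a column at its own row, and columns on the path land on tight edges. *)
Lemma insert_spec jj s (B : 'M[R]_n) x :
  imem s 0 0%N 0%N = n -> imem s 6 0%N 0%N = jj -> (jj < n)%N ->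
  stores_mx 2 B s -> line_sums x B -> 0 < x -> feasible_matching n s ->
  wp insert s (fun s' t =>
    [/\ frame [:: 3; 4; 5; 7; 8; 9; 10; 11; 12; 13] [:: 5; 6; 7] s s',
        feasible_matching n s',
        forall c, (c < n)%N -> (c == jj) || tight s c -> tight s' c
      & (t <= 3500 * n ^ 3)%N]).
Proof.
move=> sn sjj jjn sB sumsB x0 feas.
apply: wp_seq; apply: (@wp_for _ _ _ _ _ n.+1 50 (fun k s1 =>
    frame [:: 4; 7] [::] s s1 /\ forall c, (c < k)%N -> used s1 c = 0%N)).
- by rewrite /= /update /= sn.
- by split=> //; frame_tac.
- move=> k s1 kn [fr1 used1] s1k; apply: wp_iset; rewrite /= s1k; split=> //.
    by rewrite /update /= fr1.1 ?sn.
  split; first by frame_tac.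
  move=> c; rewrite ltnS leq_eqVlt /update /=; case: eqP => //= _; exact: used1.
move=> s1 t1 [fr1 used1] t1le.
do 3!(apply/wp_seq/wp_iset); rewrite /= /update /= !fr1.1 // sn sjj.
set s4 := iset _ 9 _ _ _.
have used4 c : (c < n)%N -> used s4 c = 0%N.
  by move=> cn; rewrite /s4 /= /update /= (ltn_eqF cn) used1 // (ltn_trans cn).
have jj_n : in_play n jj by rewrite /in_play (ltnW jjn) ltn_eqF.
have fr4 : frame [:: 3; 4; 7; 9] [::] s s4.
  rewrite /s4; frame_tac; exact: frame_sub fr1.
have n_sq : (n <= n * n)%N by rewrite leq_pmulr.
have feas4 : feasible_matching jj s4.
  pose s2 := iset s1 4 0 n 1.
  have feas2 : feasible_matching n s2.
    by apply: (feasible_matching_frame (xs := [:: 4; 7]) (ys := [::]) (s := s)) => //;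
       rewrite /s2; frame_tac.
  have feas3 : feasible_matching jj (iset s2 3 0 n (p s jj)).
    by rewrite -(fr1.1 3) //; exact: feasible_matching_move jj_n feas2.
  apply: (feasible_matching_frame (xs := [:: 9]) (ys := [::]) _ _ _ _ _ _ feas3) => //.
  by rewrite /s4; frame_tac.
have cnt4 : #|unused s4| = n.
  by rewrite -[RHS]card_ord; apply: eq_card => j; rewrite inE used4.
have tree4 : tree jj s4 s4.
  split=> //.
  - by rewrite /s4 /= /update /= eqxx.
  - by rewrite cnt4.
  - move=> c; rewrite leq_eqVlt => /orP[/eqP ->|cn]; last by rewrite used4.
    by rewrite /s4 /= /update /= eqxx.
  - by move=> c cn; rewrite used4.
have sB4 : stores_mx 2 B s4 by move=> i j; rewrite fr4.2.
have sn4 : imem s4 0 0%N 0%N = n by rewrite fr4.1.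
apply: wp_seq; apply: (@wp_while _ _ _ _ (tree jj s4)
    (fun s5 => (#|unused s5|.+1) * (1400 * (n * n) + 20))%N) => //.
- move=> s5 tree5; rewrite /= ((tree_frame tree5).1 6) // (fr4.1 6) // sjj leqn0 => /eqP jj5.
  apply: wp_mono (grow_spec sn4 sB4 sumsB x0 tree5 jj5) _.
  move=> s6 t6 [tree6 lt56 t6le]; split=> //.
  have := leq_mul lt56 (leqnn (1400 * (n * n) + 20)).
  by rewrite /= [in leqRHS]mulSn; lia.
- by move=> s5 _ _ /=; rewrite mulSn; lia.
move=> s5 t5 tree5; rewrite /= ((tree_frame tree5).1 6) // (fr4.1 6) // sjj -ltnNge.
rewrite cnt4 => jj5 t5le.
have fr5 := tree_frame tree5.
apply/wp_seq/wp_iset; rewrite /= (fr5.1 6) // (fr4.1 6) // sjj.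
set s6 := iset s5 13 _ _ _.
have tree6 : tree jj s4 s6.
  by case: tree5 => *; split=> //; rewrite /s6; frame_tac.
have sn6 : imem s6 0 0%N 0%N = n by rewrite [imem s6 _ _ _](fr5.1 0).
apply: wp_mono (trace_spec sn6 jjn tree6 jj5 erefl) _ => s7 t7 [fr7 feas7 tight7 t7le].
split=> //.
- apply: (frame_trans (s' := s4)); first exact: frame_sub fr4.
  by apply: frame_trans (frame_sub _ _ (tree_frame tree6)) (frame_sub _ _ fr7).
- move=> c cn old; apply: tight7 => //; move: old.
  case: (eqVneq c jj) => //= cjj.
  have p6 : p s6 c = p s c.
    rewrite [p s6 c](fr5.1 3) // /s4 /= /update /= (ltn_eqF cn).
    by rewrite fr1.1.
  have slack6 : slack s6 c c = slack s c c.
    rewrite (tree_slack tree6) // /slack !fr4.2 //.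
    by rewrite -[p s4 c](fr5.1 3) // [p s5 c]p6.
  by rewrite /tight slack6 p6 [rmem s6 _ _ _](fr5.2 2) // fr4.2.
- have : (n * n <= n * (n * n))%N by rewrite leq_pmull.
  have : (0 < n * n)%N by rewrite muln_gt0 n_gt0.
  have E : (n.+1 * (1400 * (n * n) + 20) =
      1400 * (n * (n * n)) + 1400 * (n * n) + 20 * n + 20)%N by lia.
  move: t5le t1le; rewrite /= E !expnS expn0 muln1.
  lia.
Qed.

(** * Initial matching and potentials *)

Lemma initialise_spec s : imem s 0 0%N 0%N = n ->
  wp initialise s (fun s' t =>
    [/\ frame [:: 1; 3; 7; 8] [:: 2; 4; 5] s s',
        imem s' 1 0%N 0%N = 0%N, rmem s' 4 0%N 0%N = 1,
        (forall i j, (i < n)%N -> (j < n)%N -> b s' i j = rmem s 1 i j) /\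
        feasible_matching n s' & (t <= 1000 * (n * n))%N]).
Proof.
move=> sn; apply/wp_seq/wp_iset/wp_seq/wp_rset.
set s0 := rset _ _ _ _ _.
have fr0 : frame [:: 1; 3; 7; 8] [:: 2; 4; 5] s s0 by rewrite /s0; frame_tac.
pose done s1 i j := b s1 i j = rmem s 1 i j /\ rmem s 0 i j <= u s1 i + v s j.
pose ready s1 := [/\ frame [:: 1; 3; 7; 8] [:: 2; 4; 5] s s1,
  imem s1 1 0%N 0%N = 0%N & rmem s1 4 0%N 0%N = 1].
apply: (@wp_for _ _ _ _ _ n (200 * n) (fun k s1 =>
  [/\ ready s1, forall c, (c < k)%N -> p s1 c = c &
      forall i j, (i < k)%N -> (j < n)%N -> done s1 i j])).
- by rewrite /= /update /= sn.
- by split=> //; split=> //; frame_tac.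
- move=> k s1 kn [[fr1 s1_1 s1_4] p1 done1] s1k.
  have s1n : imem s1 0 0%N 0%N = n by rewrite fr1.1.
  apply/wp_seq/wp_iset; rewrite /= s1k; set s2 := iset _ _ _ _ _.
  have p2 c : (c < k.+1)%N -> p s2 c = c.
    by rewrite ltnS leq_eqVlt /s2 /= /update /=; case: eqP => //= _ /p1.
  apply: (@wp_for _ _ _ _ _ n 60 (fun l s3 =>
    [/\ ready s3, imem s3 7 0%N 0%N = k, forall c, (c < k.+1)%N -> p s3 c = c &
      forall i j, ((i < k) && (j < n) || (i == k) && (j < l))%N -> done s3 i j])) => //.
  + split=> //; first by split=> //; rewrite /s2; frame_tac.
    by move=> i j; rewrite andbF orbF => /andP[ik jn]; have := done1 i j ik jn.
  + move=> l s3 ln [[fr3 s3_1 s3_4] s3k p3 done3] s3l.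
    have s3n : imem s3 0 0%N 0%N = n by rewrite fr3.1.
    have split_lt i j : ((i < k) && (j < n) || (i == k) && (j < l.+1))%N ->
        ((i == k) && (j == l)) || ((i < k) && (j < n) || (i == k) && (j < l))%N.
      rewrite [(j < l.+1)%N]ltnS [(j <= l)%N]leq_eqVlt.
      by case: (i < k)%N; case: (j < n)%N; case: (i == k); case: (j == l).
    apply/wp_seq/wp_rset/wp_if; rewrite /= /update /= s3k s3l !(fr3.2 0, fr3.2 1, fr3.2 6) //.
    case: ifP => test.
      apply: wp_skip; split=> //.
      split=> //; first by split=> //; frame_tac.
      move=> i j /split_lt/orP[/andP[/eqP -> /eqP ->]|/done3[d1 d2]];
        rewrite /done /= /update /=; first by rewrite !eqxx.
      by rewrite d1; split=> //; case: (i =P k) => [->|_]; case: (j =P l) => [->|_].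
    apply: wp_rset; rewrite /= /update /= s3k s3l; split=> //.
    split=> //; first by split=> //; frame_tac.
    (* Row potentials are only ever raised, which preserves the constraints already established. *)
    have lt_test : u s3 k <= rmem s 0 k l - v s l.
      by move/negbT: test; rewrite -ltNge => /ltW; rewrite lerBrDr.
    move=> i j /split_lt/orP[/andP[/eqP -> /eqP ->]|/done3[d1 d2]];
      rewrite /done /= /update /= !(fr3.2 0, fr3.2 6) //; first by rewrite !eqxx subrK.
    rewrite d1; split; first by case: (i =P k) => [->|_]; case: (j =P l) => [->|_].
    case: (i =P k) d2 => [->|//] d2; apply: le_trans d2 _.
    by rewrite lerD2r.
  + move=> s' t [[fr' s'1 s'4] s'k p' done'] tle; split=> //.
    * by rewrite /= /update /= fr'.1 ?sn.
    * split=> //; first by split=> //; frame_tac.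
      move=> i j; rewrite ltnS leq_eqVlt => ik jn; apply: done'.
      by rewrite jn !andbT orbC.
    * by rewrite /= in tle *; nia.
- move=> s' t [[fr' s'1 s'4] p' done'] tle.
  split=> //; last by move: tle => /=; nia.
  split; first by move=> i j ik jn; case: (done' i j ik jn).
  have play c : in_play n c -> (c < n)%N.
    by rewrite /in_play ltn_neqAle andbC.
  split.
  + by move=> c /play cn; rewrite p'.
  + by move=> c c' /play cn /play c'n; rewrite !p'.
  + move=> c j /play cn jn _; rewrite /slack p' // subr_ge0 !(fr'.2 0, fr'.2 6) //.
    by case: (done' c j cn jn).
Qed.

(** * One iteration: repair, minimum and subtraction *)

Definition bad s : {set 'I_n} := [set c : 'I_n | ~~ tight s c].

(** An insertion makes its column tight and spoils no other, so the number of non-tight columns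
    serves as potential, each worth one cubic insertion. *)
Lemma repair_spec s (B : 'M[R]_n) x :
  imem s 0 0%N 0%N = n -> stores_mx 2 B s -> line_sums x B -> 0 < x ->
  feasible_matching n s ->
  wp repair s (fun s' t =>
    [/\ frame [:: 3; 4; 5; 6; 7; 8; 9; 10; 11; 12; 13] [:: 5; 6; 7] s s',
        feasible_matching n s', forall c, (c < n)%N -> tight s' c
      & (t <= 3500 * n ^ 3 * #|bad s| + 250 * n)%N]).
Proof.
move=> sn sB sumsB x0 feas.
apply: (@wp_for_amortized _ _ _ _ _ n 60 (fun k s1 =>
   [/\ frame [:: 3; 4; 5; 6; 7; 8; 9; 10; 11; 12; 13] [:: 5; 6; 7] s s1,
       feasible_matching n s1 & forall c, (c < k)%N -> tight s1 c])
   (fun s1 => 3500 * n ^ 3 * #|bad s1|)%N).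
- by rewrite /= /update /= sn.
- by split=> //; frame_tac.
- move=> k s1 kn [fr1 feas1 tight1] s1k.
  have s1n : imem s1 0 0%N 0%N = n by rewrite fr1.1.
  have sB1 : stores_mx 2 B s1 by move=> i j; rewrite fr1.2 ?sB.
  apply: wp_if; set bt := beval s1 _.
  have -> : bt = tight s1 k by rewrite /bt /= s1k /tight -ltNge.
  have [tk|ntk] := boolP (tight s1 k).
    apply: wp_skip; split=> //; last by rewrite leq_add2r.
    split=> //; first by frame_tac.
    move=> c; rewrite ltnS leq_eqVlt => /orP[/eqP ->|/tight1] //.
  apply: wp_mono (insert_spec s1n s1k kn sB1 sumsB x0 feas1) _.
  move=> s2 t2 [fr2 feas2 tight2 t2le]; split.
  + by rewrite fr2.1.
  + by rewrite /= /update /= fr2.1.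
  + split=> //.
      apply: frame_iset => //; apply: frame_trans fr1 _.
      exact: frame_sub fr2.
    move=> c; rewrite ltnS => ck; apply: (tight2 c); first exact: leq_ltn_trans kn.
    by move: ck; rewrite leq_eqVlt => /orP[->|/tight1 ->] //; rewrite orbT.
  + have : (#|bad s2| < #|bad s1|)%N.
      apply/proper_card/properP; split.
        apply/subsetP => c; rewrite !inE; apply: contra => tc.
        by apply: tight2 => //; rewrite tc orbT.
      exists (Ordinal kn); rewrite !inE //= negbK.
      by apply: tight2 => //=; rewrite eqxx.
    move=> lt; have := leq_mul (leqnn (3500 * n ^ 3)) lt.
    rewrite -[bad (iset _ _ _ _ _)]/(bad s2) mulnS /=; lia.
- move=> s' t [fr' feas' tight'] tle; split=> //.
  rewrite -[bad (iset _ _ _ _ _)]/(bad s) in tle; move: tle => /=; nia.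
Qed.

Lemma find_min_spec s : imem s 0 0%N 0%N = n ->
  wp find_min s (fun s' t =>
    [/\ frame [:: 7] [:: 8] s s',
        exists2 c, (c < n)%N & rmem s' 8 0%N 0%N = b s (p s c) c,
        forall c, (c < n)%N -> rmem s' 8 0%N 0%N <= b s (p s c) c
      & (t <= 250 * n)%N]).
Proof.
move=> sn; apply/wp_seq/wp_rset; set s0 := rset _ _ _ _ _.
have fr0 : frame [:: 7] [:: 8] s s0 by rewrite /s0; frame_tac.
apply: (@wp_for _ _ _ _ _ n 60 (fun k s1 => [/\ frame [:: 7] [:: 8] s s1,
    exists2 c, (c < n)%N & rmem s1 8 0%N 0%N = b s (p s c) c &
    forall c, (c < k)%N -> rmem s1 8 0%N 0%N <= b s (p s c) c])).
- by rewrite /= /update /= sn.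
- by split=> //; [frame_tac|exists 0%N].
- move=> k s1 kn [fr1 min1 le1] s1k; apply: wp_if.
  rewrite /= !s1k !(fr1.1 3) // (fr1.2 2) //; case: ifP => test.
    apply: wp_rset; rewrite /= s1k (fr1.1 3) // (fr1.2 2) //; split=> //.
      by rewrite /update /= fr1.1.
    split; [by frame_tac|by exists k|].
    move=> c; rewrite ltnS leq_eqVlt /= /update /= => /orP[/eqP -> //|/le1].
    exact: le_trans.
  apply: wp_skip; split=> //; first by rewrite /= /update /= fr1.1.
  split=> //; first by frame_tac.
  move=> c; rewrite ltnS leq_eqVlt /= => /orP[/eqP ->|/le1] //.
  by apply/ltW; rewrite ltNge test.
- by move=> s' t [fr' min' le'] tle; split=> //; move: tle => /=; lia.
Qed.

Lemma subtract_spec s : imem s 0 0%N 0%N = n -> feasible_matching n s ->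
  let m := rmem s 8 0%N 0%N in let k := imem s 1 0%N 0%N in
  wp subtract s (fun s' t =>
    [/\ frame [:: 2; 7] [:: 2] s s',
        forall i j, (j < n)%N -> b s' i j = b s i j - (if i == p s j then m else 0),
        forall c, (c < n)%N -> imem s' 2 k (p s c) = c,
        forall k' i, k' != k -> imem s' 2 k' i = imem s 2 k' i
      & (t <= 250 * n)%N]).
Proof.
move=> sn [_ inj _] m k.
have play c : (c < n)%N -> in_play n c by move=> cn; rewrite /in_play ltnW // ltn_eqF.
apply: (@wp_for _ _ _ _ _ n 60 (fun l s1 => [/\ frame [:: 2; 7] [:: 2] s s1,
    forall i j, (j < n)%N ->
      b s1 i j = b s i j - (if (j < l)%N && (i == p s j) then m else 0),
    forall c, (c < l)%N -> imem s1 2 k (p s c) = c &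
    forall k' i, k' != k -> imem s1 2 k' i = imem s 2 k' i])).
- by rewrite /= /update /= sn.
- by split=> //; [frame_tac|move=> i j _; rewrite subr0].
- move=> l s1 ln [fr1 b1 perm1 old1] s1l.
  apply/wp_seq/wp_rset/wp_iset; rewrite /= /update /= !s1l !(fr1.1 3, fr1.1 1, fr1.2 8) //.
  rewrite -/k -/m; split=> //.
    by rewrite /= /update /= fr1.1.
  split; first by frame_tac.
  + have bl : b s1 (p s l) l = b s (p s l) l by rewrite b1 // ltnn subr0.
    move=> i j jn; rewrite /= /update /= bl b1 // ltnS [(j <= l)%N]leq_eqVlt.
    case: (j =P l) => [->|_]; last by rewrite andbF.
    by rewrite ltnn andbT; case: (i =P p s l) => [->|_]; rewrite /= ?subr0.
  + move=> c; rewrite ltnS leq_eqVlt /= /update /= eqxx => cl.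
    have cn : (c < n)%N by move: cl ln; case/orP => [/eqP ->|/ltn_trans]; auto.
    case: (p s c =P p s l) => [/inj -> //|ne]; [exact: play|exact: play|].
    by case/orP: cl => [/eqP cl|/perm1] //; rewrite cl in ne.
  + by move=> k' i kk'; rewrite /= /update /= (negbTE kk') old1.
- move=> s' t [fr' b' perm' old'] tle; split=> //.
    by move=> i j jn; rewrite b' // jn.
  by move: tle => /=; lia.
Qed.

Lemma feasible_matching_perm s : feasible_matching n s ->
  exists t : 'S_n, forall c : 'I_n, p s c = t c.
Proof.
move=> [row inj _].
have play (c : 'I_n) : in_play n c by rewrite /in_play (ltnW (ltn_ord c)) ltn_eqF.
pose f (c : 'I_n) := Ordinal (row c (play c)).
have f_inj : injective f by move=> c c' /(congr1 val) /inj E; apply/val_inj/E.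
by exists (perm f_inj) => c; rewrite permE.
Qed.

Variable S : 'M[R]_n.

Record loop_head (B : 'M[R]_n) L s : Prop := LoopHead {
  head_n : imem s 0 0%N 0%N = n;
  head_score : stores_mx 0 S s;
  head_config : holds_config (B, L) s;
  head_feasible : feasible_matching n s;
  head_sums : line_sums (rmem s 4 0%N 0%N) B
}.

(** After [repair] the potentials certify the stored permutation as the argmax. The two cardinality
    claims feed the amortised count over the whole run. *)
Lemma iteration_spec B L s : loop_head B L s -> 0 < rmem s 4 0%N 0%N ->
  wp iteration s (fun s' t => exists P,
    [/\ is_argmax S B P,
        loop_head (B - min_entry B P *: P) (rcons L (min_entry B P, P)) s',
        (0 < #|bad s'|)%N,
        (#|support (B - min_entry B P *: P)| + #|bad s'| <= #|support B|)%N
      & (t <= 3500 * n ^ 3 * #|bad s| + 1000 * n)%N]).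
Proof.
move=> [sn sS [sB [sL sLs]] feas sums] x0; rewrite /= in sB sL sLs.
apply: wp_seq; apply: wp_mono (repair_spec sn sB sums x0 feas) _.
move=> s1 t1 [fr1 feas1 tight1 t1le].
have s1n : imem s1 0 0%N 0%N = n by rewrite fr1.1.
apply: wp_seq; apply: wp_mono (find_min_spec s1n) _.
move=> s2 t2 [fr2 [c0 c0n minE] min_le t2le].
have s2n : imem s2 0 0%N 0%N = n by rewrite fr2.1.
have feas2 : feasible_matching n s2 by apply: (feasible_matching_frame fr2).
apply: wp_seq; apply: wp_mono (subtract_spec s2n feas2) _.
move=> s3 t3 [fr3 b3 perm3 old3 t3le].
do 2!(apply/wp_seq/wp_rset); apply: wp_iset.
rewrite /= /update /=.
have [t tE] := feasible_matching_perm feas1.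
pose P : 'M[R]_n := perm_mx t^-1.
have B0 : nonnegative B by case: sums.
have b1 i j : b s1 i j = b s i j by rewrite fr1.2.
have PE i j : (P i j == 1) = (i == t j).
  by rewrite perm_mx_eq1 (canF_eq (permKV t)).
have PE1 i j : P i j = (i == t j)%:R by rewrite /P !mxE (canF_eq (permKV t)).
have play (c : 'I_n) : in_play n c by rewrite /in_play (ltnW (ltn_ord c)) ltn_eqF.
have [_ _ feas1'] := feas1.
have tightP (k : 'I_n) : 0 < B (t k) k /\ S (t k) k = u s1 (t k) + v s1 k.
  have := tight1 k (ltn_ord k); rewrite /tight tE b1 sB => /andP[bk slk]; split=> //.
  have sl0 : slack s1 k k = 0.
    by apply/le_anti; rewrite slk feas1' ?ltn_ord // tE b1 sB.
  by apply/esym/subr0_eq; rewrite -sl0 /slack tE (fr1.2 0) // sS.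
have argP : is_argmax S B P.
  apply: (is_argmax_dual (u := fun i => u s1 i) (v := fun j => v s1 j)).
  - move=> i j bij; have := feas1' (t^-1%g i) j (play _) (ltn_ord j).
    by rewrite /slack tE permKV b1 sB => /(_ bij); rewrite (fr1.2 0) // sS subr_ge0.
  - by move=> i; have [] := tightP (t^-1%g i); rewrite permKV.
  - by move=> i; have [_] := tightP (t^-1%g i); rewrite permKV.
have minPE : min_entry B P = rmem s2 8 0%N 0%N.
  apply/le_anti/andP; split.
    rewrite minE (tE (Ordinal c0n)) b1 -[c0]/(nat_of_ord (Ordinal c0n)) sB.
    by apply: min_entry_le; apply/eqP; rewrite PE.
  have [i [j [/eqP Pij ->]]] := min_entry_attained B n_gt0 argP.1.1.
  by move: Pij; rewrite PE => /eqP ->; rewrite -sB -b1 -tE; exact: min_le.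
set s4 := iset _ 1 _ _ _.
have p4 c : p s4 c = p s1 c by rewrite [p s4 c](fr3.1 3) // fr2.1.
have slack4 c j : slack s4 c j = slack s1 c j.
  by rewrite /slack p4 /s4 /= /update /= !(fr3.2, fr2.2).
have b4 i j : (j < n)%N ->
    b s4 i j = b s1 i j - (if i == p s1 j then min_entry B P else 0).
  by move=> jn; rewrite [b s4 _ _]b3 // minPE fr2.2 // fr2.1.
have sB' : stores_mx 2 (B - min_entry B P *: P) s4.
  move=> i j; rewrite b4 // b1 sB tE [in RHS]mxE [in RHS]mxE [in RHS]mxE PE1.
  rewrite -[(i == t j :> nat)]/(i == t j).
  by case: (i == t j); rewrite ?mulr1 ?mulr0.
(* Subtraction changes neither potentials nor matching, so no slack changes and a column is spoilt
   only by losing its entry. *)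
have bad4 : bad s4 = [set j | ~~ (0 < (B - min_entry B P *: P) (t j) j)].
  apply/setP => j; rewrite !inE /tight slack4 p4 tE sB'.
  by case/andP: (tight1 j (ltn_ord j)) => _ ->; rewrite andbT.
have [bad_gt0 support_le] := card_support_sub n_gt0 B0 argP.1.
have s3_1 : imem s3 1 0%N 0%N = size L by rewrite fr3.1 // fr2.1 // fr1.1.
exists P; split=> //.
- split.
  + by rewrite [imem s4 _ _ _](fr3.1 0) // fr2.1.
  + by move=> i j; rewrite [rmem s4 _ _ _](fr3.2 0) // fr2.2 // fr1.2.
  + split=> //=; split; first by rewrite size_rcons /s4 /= /update /= s3_1.
    move=> k; rewrite size_rcons ltnS leq_eqVlt nth_rcons => /orP[/eqP ->|kL].
      rewrite ltnn eqxx /s4 /= /update /= s3_1 eqxx; split.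
        by rewrite minPE fr3.2.
      move=> i j; have := perm3 (t^-1%g i) (ltn_ord _).
      rewrite !(fr2.1, fr1.1 1) // sL tE permKV => ->.
      split=> [/val_inj <-|/eqP]; first by apply/eqP; rewrite PE permKV.
      by rewrite PE => /eqP ->; rewrite permK.
    rewrite kL; have [coef perm] := sLs k kL; split.
      by rewrite /s4 /= /update /= s3_1 (ltn_eqF kL) fr3.2 // fr2.2 // fr1.2.
    move=> i j; rewrite -perm [imem s4 2 k i]old3 ?fr2.1 ?fr1.1 //.
    by rewrite sL ltn_eqF.
  + have [row1 inj1 _] := feas1; split.
    * by move=> c; rewrite p4; exact: row1.
    * by move=> c c'; rewrite !p4; exact: inj1.
    * move=> c j cn jn; rewrite p4 slack4 b4 // => bj; apply: feas1' => //.
      apply: lt_le_trans bj _; rewrite gerBl; case: ifP => // _.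
      by rewrite min_entry_ge0 //; case: argP => -[].
  + have -> : rmem s4 4 0%N 0%N = rmem s 4 0%N 0%N - min_entry B P.
      by rewrite minPE /s4 /= /update /= !(fr3.2, fr2.2 4, fr1.2).
    exact: line_sums_sub.
- by rewrite bad4.
- by rewrite bad4.
- move: t1le; set X := (3500 * n ^ 3 * _)%N; move: X => X t1le /=.
  lia.
Qed.

(** Induction on the size of the support, which drops in every iteration; the run and the execution
    are built together. Cubic costs are charged to the columns not tight at the start and, for those
    spoilt later, to lost support entries. *)
Lemma run_spec B L s : loop_head B L s ->
  exists cs hs s' t,
    [/\ birkhoff_run S B L cs /\ exec (While positive_sums iteration) s s' t,
        loop_heads positive_sums iteration s hs /\ size hs = size cs,
        forall k, (k < size cs)%N -> holds_config (nth (0, [::]) cs k) (nth s hs k),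
        forall d, stores_terms (last d cs).2 s'
      & (t <= 3500 * n ^ 3 * (#|support B| + #|bad s|) + 1020 * n * #|support B| + 20)%N].
Proof.
have [m] := ubnP #|support B|; elim: m => // m IH in B L s * => suppB head.
have [test|ntest] := boolP (beval s positive_sums); last first.
  have B0 : B = 0.
    by apply/(line_sums_eq0 n_gt0 (head_sums head)); move: ntest; rewrite /= negbK.
  exists [:: (0, L)], [:: s], s, (1 + bcost positive_sums)%N; split.
  - by rewrite B0; split; [exact: run_stop|exact: exec_while_stop].
  - by split=> //; exact: heads_stop.
  - by move=> [|//] _; rewrite -B0; exact: head_config head.
  - by move=> d; case: (head_config head).
  - by rewrite /=; lia.
have x0 : 0 < rmem s 4 0%N 0%N by rewrite ltNge.
have [s1 [t1 [exec1 [P [argP head1 bad_gt0 supp_le t1le]]]]] := iteration_spec head x0.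
have [|cs [hs [s' [t [[run exec_s'] [heads hs_size] cfg terms tle]]]]] := IH _ _ _ _ head1.
  by move: suppB supp_le bad_gt0; lia.
exists ((B, L) :: cs), (s :: hs), s', (1 + bcost positive_sums + t1 + t)%N; split.
- split; last exact: exec_while_iter exec1 exec_s'.
  by apply: run_iter run => //; exact: perfect_matching_neq0 n_gt0 argP.1.
- by split; [exact: heads_iter exec1 heads|rewrite /= hs_size].
- move=> [_|k kcs] /=; first exact: head_config head.
  by rewrite (set_nth_default s1) ?hs_size //; exact: cfg.
- by move=> d; exact: terms.
- move: t1le tle supp_le bad_gt0; rewrite [bcost _]/=.
  move: (3500 * n ^ 3)%N #|support B| #|support (_ - _)| #|bad s| #|bad s1|.
  move=> X a a' c c' t1le tle le c'_gt0.
  (* As [c'] is positive, [a' + c' <= a] also yields [a'.+1 <= a], so the linear overhead of the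
     iteration is charged to a lost entry too. *)
  have : (X * (a' + c') <= X * a)%N by rewrite leq_mul2l le orbT.
  have : (1020 * n * a'.+1 <= 1020 * n * a)%N by rewrite leq_mul2l; apply/orP; right; lia.
  by move: t1le tle; rewrite mulnS !mulnDr; lia.
Qed.

End Hungarian.

(** * Existence, uniqueness and running time combined *)

Theorem theorem2p7 (R : realType) :
  exists (init : com) (test : bexp) (body : com) (C : nat),
  forall (n : nat) (S A : 'M[R]_n),
    (0 < n)%N -> identifying S -> doubly_stochastic A ->
    exists cs : seq ('M[R]_n * seq (R * 'M[R]_n)),
      [/\ birkhoff_run S A [::] cs,
          forall cs', birkhoff_run S A [::] cs' -> cs' = cs,
          (last (A, [::]) cs).2 = nonzero_terms (induced_decomposition S A)
        & forall s : state R, holds_input S A s ->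
          exists (s1 s2 : state R) (t1 t2 : nat),
            [/\ exec init s s1 t1,
                exec (While test body) s1 s2 t2,
                loop_follows test body s1 cs,
                stores_terms (nonzero_terms (induced_decomposition S A)) s2
              & (t1 + t2 <= C * n ^ 5)%N]].
Proof.
(* The contributions add up to at most [1000 + 2 * 3500 + 1020 + 20 = 9040] times [n ^ 5]. *)
exists initialise, positive_sums, iteration, (10 * 1000)%N => n S A n_gt0 idS dsA.
have start (s : state R) : holds_input S A s -> exists s1 t1,
    [/\ exec initialise s s1 t1, loop_head S A [::] s1 & (t1 <= 1000 * (n * n))%N].
  move=> [sn sS sA]; have [s1 [t1 [exec1 spec1]]] := initialise_spec n_gt0 sn.
  have [fr1 s1_1 s1_4 [sB feas1] t1le] := spec1.
  exists s1, t1; split=> //; split=> //.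
  - by rewrite fr1.1.
  - by move=> i j; rewrite fr1.2.
  - by split=> [i j|//]; rewrite sB.
  - by rewrite s1_4.
(* The run [cs] must be chosen before any memory is given. It is read off an execution from one
   concrete memory holding the input, in which all index cells contain [n] and [ext] pads the
   matrices with 0. *)
pose ext (M : 'M[R]_n) (i j : nat) : R :=
  if (insub i, insub j) is (Some i', Some j') then M i' j' else 0.
pose s0 := State (fun _ _ _ => n) (fun a => ext (if a == 0%N then S else A)).
have input0 : holds_input S A s0 by split=> // i j; rewrite /= /ext !valK.
have [s1 [_ [_ head1 _]]] := start s0 input0.
have [cs [_ [_ [_ [[run _] _ _ _ _]]]]] := run_spec n_gt0 head1.
have A0 : nonnegative A by case: dsA.
have decE d := birkhoff_run_induced d n_gt0 idS A0 run.
exists cs; split=> // [cs' run'|s input].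
  exact: birkhoff_run_unique idS run run'.
have [s2 [t1 [exec1 head2 t1le]]] := start s input.
have [cs' [hs [s3 [t2 [[run' exec2] [heads hs_size] cfg terms t2le]]]]] :=
  run_spec n_gt0 head2.
(* By uniqueness, the run found for an arbitrary memory is the one already chosen. *)
have csE := birkhoff_run_unique idS run run'; rewrite {cs'}csE in run' hs_size cfg terms.
exists s2, s3, t1, t2; split=> //.
- by exists hs.
- by rewrite -(decE (A, [::])).
- have supp_le : (#|support A| <= n * n)%N.
    by apply: leq_trans (max_card _) _; rewrite card_prod card_ord.
  have bad_le : (#|bad n s2| <= n)%N.
    by apply: leq_trans (max_card _) _; rewrite card_ord.
  have n5 k : (k <= 4)%N -> (n ^ k <= n ^ 5)%N by move=> k4; rewrite leq_pexp2l // ltnW.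
  have X_le : (n ^ 3 * (#|support A| + #|bad n s2|) <= n ^ 5 + n ^ 4)%N.
    have -> : (n ^ 5 + n ^ 4 = n ^ 3 * (n * n + n))%N by rewrite mulnDr mulnn -expnD -expnSr.
    by rewrite leq_mul2l leq_add ?orbT.
  have Y_le : (n * #|support A| <= n ^ 3)%N by rewrite !expnS expn0 muln1 leq_mul2l supp_le orbT.
  have := n5 4 isT; have := n5 3 isT; have := n5 2 isT; have := n5 0 isT.
  move: t1le t2le X_le Y_le; rewrite expn0 -[(n ^ 2)%N]/(n * n)%N -!mulnA.
  move: (n ^ 5)%N (n ^ 4)%N (n ^ 3)%N (n * n)%N => N5 N4 N3 N2.
  lia.
Qed.
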